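(* Let $0<p\le 1$ and let $\mathbf g=-dt^2+t^{2p}\delta_{ij}dx^idx^j$ on $\mathbb R^+\times\mathbb R^3$. There is a constant $A_p>0$ depending only on $p$ (and allowed to blow up as $p\to0$) such that for all $0<t_0<t_1$ and every $C^2$ function $\phi:[t_0,t_1)\times\mathbb R^3\to\mathbb R$, $$\sup_{t_0\le t<t_1}E^{1/2}[\phi](t)+C(p)\,\big\|t^{p-\frac12}\partial_t\phi\big\|_{L^2[t_0,t_1]}\le A_p\Big(E^{1/2}[\phi](t_0)+\big\|t^{p+\frac12}\,\square_{\mathbf g}\phi\big\|_{L^2[t_0,t_1]}\Big),$$ where $C(p)=(2p)^{1/2}$.
   Context: $\square_{\mathbf g}\phi=-\partial_t^2\phi-\frac{3p}{t}\partial_t\phi+\frac1{t^{2p}}\Delta\phi$ is the Laplace–Beltrami operator of $\mathbf g$, with $\Delta$ the Euclidean Laplacian in $x\in\mathbb R^3$. The energy is $E[\phi](t)=\frac12\int_{\mathbb R^3}\big(t^{2p}(\partial_t\phi)^2+|\nabla_x\phi|^2\big)(t,x)\,dx$. The spacetime norm is $\|f\|_{L^2[t_0,t_1]}^2=\int_{t_0}^{t_1}\int_{\mathbb R^3}|f(t,x)|^2\,dx\,dt$. Norms may take the value $+\infty$. *)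

(* Defs.v *)
From HB Require Import structures.
From mathcomp Require Import all_boot all_order all_algebra.
From mathcomp Require Import all_classical all_reals all_analysis.
Set Implicit Arguments.
Unset Strict Implicit.
Unset Printing Implicit Defensive.
Import Order.TTheory GRing.Theory Num.Theory.
Import numFieldNormedType.Exports.
Local Open Scope classical_set_scope.
Local Open Scope ring_scope.

(* Directional derivatives relative to a set D: the increments are restricted
   to those that stay in D, so that only the values of f on D matter, the
   derivative is one-sided at boundary points of D, and it is [derive] at
   interior points of D. *)
Definition derivable_in (R : realType) (V : normedModType R) (D : set V)
    (f : V -> R) (a v : V) : Prop :=
  cvg (h^-1 *: (f (h *: v + a) - f a)
         @[h --> within [set h : R | D (h *: v + a)] 0^']).

Definition derive_in (R : realType) (V : normedModType R) (D : set V)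
    (f : V -> R) (a v : V) : R :=
  lim (h^-1 *: (f (h *: v + a) - f a)
         @[h --> within [set h : R | D (h *: v + a)] 0^']).

(* Points of spacetime are pairs (t, x) : R * (R * R * R).  Coordinate vector
   fields: index 0 is t, indices 1, 2, 3 are x1, x2, x3. *)
Definition coord_vec (R : realType) (mu : 'I_4) : R * (R * R * R) :=
  ((mu == 0%N :> nat)%:R,
   ((mu == 1%N :> nat)%:R, (mu == 2%N :> nat)%:R, (mu == 3%N :> nat)%:R)).

Definition partial (R : realType) (D : set (R * (R * R * R))) (mu : 'I_4)
    (f : R * (R * R * R) -> R) : R * (R * R * R) -> R :=
  fun a => derive_in D f a (coord_vec R mu).

Definition C1_in (R : realType) (D : set (R * (R * R * R)))
    (f : R * (R * R * R) -> R) : Prop :=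
  {within D, continuous f} /\
  forall mu : 'I_4,
    (forall a, D a -> derivable_in D f a (coord_vec R mu)) /\
    {within D, continuous (partial D mu f)}.

Definition C2_in (R : realType) (D : set (R * (R * R * R)))
    (f : R * (R * R * R) -> R) : Prop :=
  C1_in D f /\ forall mu : 'I_4, C1_in D (partial D mu f).

Definition slab (R : realType) (t0 t1 : R) : set (R * (R * R * R)) :=
  `[t0, t1[%classic `*` [set: R * R * R].

Definition dt (R : realType) (D : set (R * (R * R * R))) :=
  partial D (ord0 : 'I_4).

Definition dx (R : realType) (D : set (R * (R * R * R))) (i : 'I_3) :=
  partial D (lift ord0 i : 'I_4).

Definition laplacian (R : realType) (D : set (R * (R * R * R)))
    (phi : R * (R * R * R) -> R) (a : R * (R * R * R)) : R :=
  \sum_(i < 3) dx D i (dx D i phi) a.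

(* Laplace-Beltrami operator of g = - dt^2 + t^(2p) dx^2, for which
   |det g|^(1/2) = t^(3p). *)
Definition box (R : realType) (p : R) (D : set (R * (R * R * R)))
    (phi : R * (R * R * R) -> R) (a : R * (R * R * R)) : R :=
  - dt D (dt D phi) a - 3 * p / a.1 * dt D phi a
  + (a.1 `^ (2 * p))^-1 * laplacian D phi a.

Definition space_integral (R : realType) (f : R * R * R -> \bar R) : \bar R :=
  (\int[lebesgue_measure \x lebesgue_measure \x lebesgue_measure]_x f x)%E.

Definition energy (R : realType) (p : R) (D : set (R * (R * R * R)))
    (phi : R * (R * R * R) -> R) (t : R) : \bar R :=
  ((2^-1)%:E * space_integral (fun x : R * R * R =>
     (t `^ (2 * p) * (dt D phi (t, x)) ^+ 2
      + \sum_(i < 3) (dx D i phi (t, x)) ^+ 2)%:E))%E.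

(* The endpoint t1 is a null set; it is left out since phi lives on
   [t0, t1) x R^3. *)
Definition L2norm (R : realType) (t0 t1 : R)
    (f : R * (R * R * R) -> R) : \bar R :=
  sqrte (\int[lebesgue_measure]_(t in `[t0, t1[)
           space_integral (fun x : R * R * R => (`|f (t, x)| ^+ 2)%:E))%E.

(* Main.v *)
From HB Require Import structures.
Require Import Defs.
From mathcomp Require Import all_boot all_order all_algebra.
From mathcomp Require Import all_classical all_reals all_analysis.
From mathcomp Require Import measurable_realfun ring lra.
Set Implicit Arguments.
Unset Strict Implicit.
Unset Printing Implicit Defensive.
Import Order.TTheory GRing.Theory Num.Theory.
Import numFieldNormedType.Exports.
Local Open Scope classical_set_scope.
Local Open Scope ring_scope.

(** With [psi = d_t phi], [chi_i = d_i phi] and [F = box phi], the wave equation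
    gives [d_t e = - 2p t^(2p-1) psi^2 - t^(2p) psi F + sum_i d_i (psi chi_i)]
    for [e = (t^(2p) psi^2 + |chi|^2) / 2], and Young's inequality bounds the
    source term by [p t^(2p-1) psi^2 + t^(2p+1) F^2 / (4p)].  No decay of [phi]
    is assumed, so this is multiplied by a compactly supported C^1 weight
    [w = max(q, 0)^2], [q = 1 - 2 K eps (t - t0) - eps^2 |x|^2], whose level sets
    shrink at least as fast as the speed of propagation [t^-p], so that the
    terms with derivatives of [w] have a sign.  Integrating over
    [[t0, b] x R^3] and letting [eps -> 0], [b -> t1] gives
    [E(t) + p |t^(p-1/2) psi|^2 <= E(t0) + |t^(p+1/2) F|^2 / (4p)] without any
    finiteness assumption. *)

(** * Measurability of continuous functions *)

(** The coefficient [-2p] is [p] from differentiating [t^(2p)] minus [3p] from the expansion term of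
    the wave operator. Young's inequality spends half of this damping on the source, whence the pair
    [p], [1 / (4p)]; the other half survives as the spacetime term on the left.

    The function [phi] is controlled only on [[t0, t1)], one-sidedly at [t0], and may be unbounded
    as [t] tends to [t1]. Hence every integration by parts is made on [[t0, b]] with [b < t1], where
    the weighted integrands are bounded with compact support. Time derivatives are used as two-sided
    derivatives only for [t > t0], and the fundamental theorem of calculus reaches [t0] by
    continuity. Spatial lines never leave the slab, so spatial derivatives need no such care. The
    interchange [d_i psi = d_t chi_i] is used at [t0] too, and is proved there with one-sided
    derivatives.

    The square in [max(q, 0)^2] removes the kink of the positive part. The limit in [eps] is taken
    by Fatou's lemma and the limit in [b] by monotone convergence, so infinite values are allowed on
    both sides. *)

(* [f x t] is the limit of [f x s_n], with [s_n > t] the next multiple of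
   [1 / n.+1], which takes countably many values. *)
Lemma measurable_fun_right_continuous d (T : measurableType d) (R : realType)
    (f : T -> R -> R) :
  (forall t, measurable_fun [set: T] (f ^~ t)) ->
  (forall x t, f x s @[s --> t^'+] --> f x t) ->
  measurable_fun [set: T * R] (fun z => f z.1 z.2).
Proof.
move=> mf cf.
pose s (n : nat) (t : R) : R := (Num.floor (n.+1%:R * t) + 1)%:~R / n.+1%:R.
apply: (@measurable_fun_cvg _ _ _ _ (fun n z => f z.1 (s n z.2))).
  move=> n.
  (* On each piece the value of [s n] is constant. The default [0], used where [unpickle] fails,
     only repeats the piece of the integer [0]; the pieces need to cover, not to be disjoint. *)
  have -> : [set: T * R] = \bigcup_k
     ([set: T] `*` [set t : R | Num.floor (n.+1%:R * t) = oapp id 0 (unpickle k)]).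
    apply/seteqP; split=> // z _.
    by exists (pickle (Num.floor (n.+1%:R * z.2))) => //=; rewrite pickleK.
  have mk k : measurable ([set: T] `*`
      [set t : R | Num.floor (n.+1%:R * t) = oapp id 0 (unpickle k)]).
    apply: measurableX => //; set j := oapp _ _ _.
    have -> : [set t : R | Num.floor (n.+1%:R * t) = j] =
        `[j%:~R / n.+1%:R, (j + 1)%:~R / n.+1%:R[%classic.
      apply/seteqP; split=> t /=; rewrite in_itv/= ler_pdivrMr ?ltr0n//
          ltr_pdivlMr ?ltr0n// mulrC.
        by move=> <-; exact: floor_itv.
      by move=> tj; apply/eqP; rewrite floor_eq.
    exact: measurable_itv.
  apply/measurable_fun_bigcup => // k.
  apply: (@eq_measurable_fun _ _ _ _ _
     (fun z => f z.1 ((oapp id 0 (unpickle k) + 1)%:~R / n.+1%:R))).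
    by move=> z /[!inE] -[_ /= zk]; rewrite /s zk.
  apply: measurable_funTS.
  exact: (measurableT_comp (mf _) measurable_fst).
move=> [x t] _ /=.
have sgt n : t < s n t.
  rewrite /s ltr_pdivlMr ?ltr0n// mulrC.
  by case/andP: (floor_itv (n.+1%:R * t)).
have /cvg_at_rightP := cf x t; apply; split=> //.
apply: (@squeeze_cvgr _ _ _ _ (cst t) (fun n => t + n.+1%:R^-1)).
- near=> n; rewrite /= ltW//= /s ler_pdivrMr ?ltr0n// mulrDl mulVf ?pnatr_eq0//.
  by rewrite intrD lerD2r [t * _]mulrC; case/andP: (floor_itv (n.+1%:R * t)).
- exact: cvg_cst.
- by rewrite -[X in _ --> X]addr0; apply: cvgD; [exact: cvg_cst|exact: cvg_harmonic].
Unshelve. all: by end_near. Qed.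

Lemma pair_continuousl (U V : topologicalType) (t : V) :
  continuous (fun v : U => (v, t)).
Proof. by move=> v; apply: (@cvg_pair _ _ _ (nbhs v)); [exact: cvg_id|exact: cvg_cst]. Qed.

Lemma pair_continuousr (U V : topologicalType) (u : U) :
  continuous (fun t : V => (u, t)).
Proof. by move=> v; apply: (@cvg_pair _ _ _ (nbhs v)); [exact: cvg_cst|exact: cvg_id]. Qed.

(** Adds one real coordinate to a space on which continuous functions are already known to be
    measurable. The map [i] keeps the measurable type apart from the topological one, so that the
    lemma can be iterated up to three coordinates. *)
Lemma continuous_measurable_prod d (T : measurableType d) (V : topologicalType)
    (i : T -> V) (R : realType) (f : V * R -> R) :
  (forall g : V -> R, continuous g -> measurable_fun [set: T] (g \o i)) ->
  continuous f -> measurable_fun [set: T * R] (fun z => f (i z.1, z.2)).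
Proof.
move=> mV cf.
apply: (@measurable_fun_right_continuous _ _ _ (fun x t => f (i x, t))).
  move=> t; apply: (mV (fun v => f (v, t))) => v.
  apply: (@continuous_comp _ _ _ (fun v => (v, t)) f); last exact: cf.
  exact: pair_continuousl.
move=> x t; apply: (@cvg_at_right_filter _ _ (fun s => f (i x, s)) t).
apply: (@continuous_comp _ _ _ (fun s => (i x, s)) f); last exact: cf.
exact: pair_continuousr.
Qed.

Lemma continuous_measurable2 (R : realType) (f : R * R -> R) :
  continuous f -> measurable_fun [set: R * R] f.
Proof.
move=> cf; rewrite (_ : f = fun z => f (z.1, z.2)); last by apply/funext => -[].
apply: (@continuous_measurable_prod _ R R id R f) => // g cg.
exact: continuous_measurable_fun.
Qed.

Lemma continuous_measurable3 (R : realType) (f : R * R * R -> R) :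
  continuous f -> measurable_fun [set: R * R * R] f.
Proof.
move=> cf; rewrite (_ : f = fun z => f (z.1, z.2)); last by apply/funext => -[].
by apply: (@continuous_measurable_prod _ (R * R)%type (R * R)%type id R f) => // g; exact: continuous_measurable2.
Qed.

Lemma pair_within_cvg (T U : topologicalType) (A : set T) (t : T) (x : U) :
  (s, x) @[s --> within A (nbhs t)] --> within (A `*` [set: U]) (nbhs (t, x)).
Proof.
move=> P /= [[B C]] /= [Bt Cx] BC; rewrite /within/=.
apply: (filterS _ Bt) => s Bs As.
by apply: (BC (s, x)) => //=; split => //; exact: nbhs_singleton.
Qed.

Lemma within_slice_continuous (T U V : topologicalType) (A : set T)
    (f : T * U -> V) (x : U) :
  {within A `*` [set: U], continuous f} ->
  {within A, continuous (fun t => f (t, x))}.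
Proof.
move=> /subspace_continuousP cf; apply/subspace_continuousP => t At.
exact: (cvg_comp _ _ (@pair_within_cvg _ _ A t x) (cf (t, x) (conj At I))).
Qed.

Lemma slice_continuous (T U V : topologicalType) (A : set T)
    (f : T * U -> V) (t : T) : A t ->
  {within A `*` [set: U], continuous f} -> continuous (fun x => f (t, x)).
Proof.
move=> At /subspace_continuousP cf x.
suff h : (t, y) @[y --> nbhs x] --> within (A `*` [set: U]) (nbhs (t, x)).
  exact: (cvg_comp _ _ h (cf (t, x) (conj At I))).
move=> P /= [[B C]] /= [Bt Cx] BC.
apply: (filterS _ Cx) => y Cy.
by apply: (BC (t, y)) => //=; split => //; exact: nbhs_singleton.
Qed.

(** Extended by zero off the slab, [f] is still right continuous in time at every [t], because the
    time interval is closed on the left and open on the right. The coordinates are swapped to put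
    time second. *)
Lemma within_continuous_measurable_slab (R : realType) (b0 b1 : R)
    (A := `[b0, b1[%classic) (f : R * (R * R * R) -> R) :
  {within A `*` [set: R * R * R], continuous f} ->
  measurable_fun (A `*` [set: R * R * R]) f.
Proof.
move=> cf.
have mA : measurable (A `*` [set: R * R * R]) by apply: measurableX => //; exact: measurable_itv.
apply/(measurable_restrictT _ mA).
pose g (x : R * R * R) (t : R) : R := (f \_ (A `*` [set: R * R * R])) (t, x).
have gE x t : g x t = if t \in A then f (t, x) else 0.
  rewrite /g patchE; congr (if _ then _ else _).
  by apply/idP/idP; rewrite !inE /=; [case|].
rewrite (_ : patch _ _ _ = (fun z => g z.1 z.2) \o (fun z => (z.2, z.1))); last first.
  by apply/funext => -[t x].
apply: measurableT_comp; last exact: measurable_swap.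
apply: measurable_fun_right_continuous => [t|x t].
  have [At|At] := boolP (t \in A).
    rewrite (_ : g^~ t = (fun x => f (t, x))); last by apply/funext => x; rewrite gE At.
    apply: continuous_measurable3; apply: slice_continuous cf; exact/set_mem.
  rewrite (_ : g^~ t = cst 0); first exact: measurable_cst.
  by apply/funext => x; rewrite gE (negbTE At).
rewrite (_ : g x = fun t => if t \in A then f (t, x) else 0); last exact/funext/gE.
have [|] := boolP (t \in A).
  rewrite inE /= /A/= in_itv/= => /andP[b0t tb1].
  have /subspace_continuousP/(_ t) := @within_slice_continuous _ _ _ _ _ x cf.
  rewrite /A /= in_itv/= b0t tb1 => /(_ isT).
  move=> /cvgrPdist_lt cv; apply/cvgrPdist_lt => e e0.
  have /nbhs_ballP[d d0 dP] := cv e e0.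
  near=> s.
  have ts : t <= s by near: s; exact: nbhs_right_ge.
  have sA : s \in A.
    by rewrite inE /A/= in_itv/= (le_trans b0t)//=; near: s; exact: nbhs_right_lt.
  rewrite sA; apply: dP; last by move: sA; rewrite inE.
  rewrite /ball/= distrC ger0_norm ?subr_ge0//; near: s.
  exact: nbhs_right_ltDr.
rewrite notin_setE /A/= in_itv/= => /negP; rewrite negb_and -ltNge -leNgt => tA.
apply: cvg_near_cst.
suff : \forall s \near t^'+, s \notin A.
  by apply: filterS => s sA; rewrite (negbTE sA).
case/orP: tA => tA; near=> s; rewrite notin_setE /A/= in_itv/=; apply/negP;
    rewrite negb_and -ltNge -leNgt; apply/orP; [left|right].
  by near: s; exact: nbhs_right_lt.
by near: s; apply: filterS (nbhs_right_ge t) => s; exact: (le_trans tA).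
Unshelve. all: by end_near. Qed.

(** * Integrals over [R^3] and over time slabs *)

Lemma compact_continuous_bounded (V : topologicalType) (R : realType)
    (K : set V) (f : V -> R) : compact K -> {within K, continuous f} ->
  exists C, forall x, K x -> `|f x| <= C.
Proof.
move=> cK cf; have /compact_bounded[M [Mr MP]] := continuous_compact cf cK.
exists (M + 1) => x Kx; apply: (MP (M + 1)); first by rewrite ltrDl.
by exists x.
Qed.

Lemma integrable_bounded_support d (T : measurableType d) (R : realType)
    (mu : {measure set T -> \bar R}) (D K : set T) (f : T -> R) (C : R) :
  measurable D -> measurable K -> (mu K < +oo)%E -> measurable_fun D f ->
  (forall x, D x -> K x -> `|f x| <= C) -> (forall x, D x -> ~ K x -> f x = 0) ->
  mu.-integrable D (EFin \o f).
Proof.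
move=> mD mK Kfin mf fC f0.
have mDK := measurableI _ _ mD mK.
apply/(integrable_mkcond _ mD).
rewrite (_ : _ \_ D = (EFin \o f) \_ (D `&` K)).
  apply/(integrable_mkcond _ mDK); apply: measurable_bounded_integrable => //.
  - by apply: le_lt_trans Kfin; apply: le_measure; rewrite ?inE//; exact: subIsetr.
  - exact: measurable_funS mf.
  - exists C; split; first exact: num_real.
    by move=> M CM x [Dx Kx] /=; rewrite (le_trans (fC _ Dx Kx))// ltW.
apply/funext => x; rewrite !patchE in_setI.
have [/set_mem Dx|//] := boolP (x \in D).
by case: ifPn => //; rewrite notin_setE => nKx; rewrite /= f0.
Qed.

Lemma product_measure_lty d1 d2 (T1 : measurableType d1)
    (T2 : measurableType d2) (R : realType)
    (m1 : {measure set T1 -> \bar R})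
    (m2 : {sigma_finite_measure set T2 -> \bar R}) (A : set T1) (B : set T2) :
  measurable A -> measurable B -> (m1 A < +oo)%E -> (m2 B < +oo)%E ->
  ((m1 \x m2) (A `*` B) < +oo)%E.
Proof.
move=> mA mB A1 B1; rewrite product_measure1E// lte_mul_pinfty//.
by rewrite ge0_fin_numE.
Qed.

Definition cube (R : realType) (L : R) : set (R * R * R) :=
  `[- L, L]%classic `*` `[- L, L]%classic `*` `[- L, L]%classic.

Lemma compact_cube (R : realType) (L : R) : compact (cube L).
Proof. by apply: compact_setX; [apply: compact_setX|]; exact: segment_compact. Qed.

Lemma measurable_cube (R : realType) (L : R) : measurable (cube L).
Proof. by apply: measurableX; [apply: measurableX|]; exact: measurable_itv. Qed.

(* The sigma-finite structure that the library puts on products is shadowed by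
   the one for products of subprobabilities, and canonical inference does not
   find it; hence the named products [vol2], [vol3], [vol4] below. *)
Lemma sigma_finite_product d1 d2 (T1 : measurableType d1)
    (T2 : measurableType d2) (R : realType)
    (m1 : {sigma_finite_measure set T1 -> \bar R})
    (m2 : {sigma_finite_measure set T2 -> \bar R}) :
  sigma_finite [set: T1 * T2] (m1 \x m2)%E.
Proof.
have /sigma_finiteP[F [TF ndF Foo]] := sigma_finiteT m1.
have /sigma_finiteP[G [TG ndG Goo]] := sigma_finiteT m2.
exists (fun n => F n `*` G n) => [|k]; last first.
  have [mF Fk] := Foo k; have [mG Gk] := Goo k; split; first exact: measurableX.
  by rewrite product_measure1E// lte_mul_pinfty// ge0_fin_numE.
apply/seteqP; split=> [[x y] _|//].
have [n _ Fnx] : (\bigcup_n F n) x by rewrite -TF.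
have [k _ Gky] : (\bigcup_n G n) y by rewrite -TG.
exists (maxn n k) => //; split => /=.
- by move: Fnx; exact/subsetPset/ndF/leq_maxl.
- by move: Gky; exact/subsetPset/ndG/leq_maxr.
Qed.

Section lebesgue_products.
Context (R : realType).
Local Notation T1 := (measurableTypeR R).
Local Notation lam := (@lebesgue_measure R).

Definition vol2 : set (T1 * T1)%type -> \bar R := (lam \x lam)%E.
HB.instance Definition _ := Measure.on vol2.
HB.instance Definition _ := Measure_isSigmaFinite.Build _ _ _ vol2
  (sigma_finite_product lam lam).

Definition vol3 : set (T1 * T1 * T1)%type -> \bar R := (vol2 \x lam)%E.
HB.instance Definition _ := Measure.on vol3.
HB.instance Definition _ := Measure_isSigmaFinite.Build _ _ _ vol3
  (sigma_finite_product vol2 lam).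

Definition vol4 : set (T1 * (T1 * T1 * T1))%type -> \bar R := (lam \x vol3)%E.
HB.instance Definition _ := Measure.on vol4.

Lemma space_integralE (f : R * R * R -> \bar R) :
  space_integral f = (\int[vol3]_x f x)%E.
Proof. by []. Qed.

End lebesgue_products.

Section lebesgue3.
Context (R : realType).
Local Notation lam := (@lebesgue_measure R).
Local Notation vol2 := (@vol2 R).
Local Notation vol3 := (@vol3 R).
Local Notation vol4 := (@vol4 R).

Lemma lebesgue_segment_lty (a b : R) : (lam `[a, b]%classic < +oo)%E.
Proof. by rewrite lebesgue_measure_itv/=; case: ifP; rewrite ?ltry. Qed.

Lemma lebesgue3_cube_fin (L : R) : (vol3 (cube L) < +oo)%E.
Proof.
rewrite /cube; apply: product_measure_lty.
- by apply: measurableX; exact: measurable_itv.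
- exact: measurable_itv.
- by apply: product_measure_lty; rewrite ?lebesgue_segment_lty//; exact: measurable_itv.
- exact: lebesgue_segment_lty.
Qed.

Lemma integrable3_cube (f : R * R * R -> R) (L : R) : continuous f ->
  (forall x, ~ cube L x -> f x = 0) -> vol3.-integrable [set: R * R * R] (EFin \o f).
Proof.
move=> cf f0.
have [C fC] := compact_continuous_bounded (@compact_cube R L) (continuous_subspaceT cf).
apply: (@integrable_bounded_support _ _ R vol3 setT (cube L) f C) => //.
- exact: measurable_cube.
- exact: lebesgue3_cube_fin.
- exact: continuous_measurable3.
- by move=> x _; exact: fC.
- by move=> x _; exact: f0.
Qed.

Lemma integrable2_cube (f : R * R -> R) (L : R) : continuous f ->
  (forall x, ~ (`[- L, L]%classic `*` `[- L, L]%classic) x -> f x = 0) ->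
  vol2.-integrable [set: R * R] (EFin \o f).
Proof.
move=> cf f0.
have cK : compact (`[- L, L]%classic `*` `[- L, L]%classic : set (R * R)).
  by apply: compact_setX; exact: segment_compact.
have [C fC] := compact_continuous_bounded cK (continuous_subspaceT cf).
have m1 : measurable (`[-L, L]%classic : set R) := measurable_itv _.
apply: (@integrable_bounded_support _ _ R vol2 setT (`[- L, L]%classic `*` `[- L, L]%classic) f C) => //.
- exact: measurableX.
- by apply: product_measure_lty => //; exact: lebesgue_segment_lty.
- exact: continuous_measurable2.
- by move=> x _; exact: fC.
- by move=> x _; exact: f0.
Qed.

(** Fubini with one chosen coordinate innermost: this lemma and the next two reduce the vanishing of
    a spatial divergence term to a statement on coordinate lines. *)
Lemma integral3_eq0_x3 (f : R * R * R -> R) (L : R) : continuous f ->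
  (forall x, ~ cube L x -> f x = 0) ->
  (forall x1 x2, (\int[lam]_s (f (x1, x2, s))%:E = 0)%E) ->
  (\int[vol3]_x (f x)%:E = 0)%E.
Proof.
move=> cf f0 i0; apply: (etrans (esym (integral12_prod_meas1 (integrable3_cube cf f0)))).
by apply: integral0_eq => -[x1 x2] _; exact: i0.
Qed.

Lemma integral3_eq0_x2 (f : R * R * R -> R) (L : R) : continuous f ->
  (forall x, ~ cube L x -> f x = 0) ->
  (forall x1 x3, (\int[lam]_s (f (x1, s, x3))%:E = 0)%E) ->
  (\int[vol3]_x (f x)%:E = 0)%E.
Proof.
move=> cf f0 i0; apply: (etrans (esym (integral21_prod_meas1 (integrable3_cube cf f0)))).
apply: integral0_eq => x3 _; rewrite /fubini_G/=.
have i2 : vol2.-integrable [set: R * R] (EFin \o (fun y => f (y, x3))).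
  apply: (@integrable2_cube _ L) => [y|y yL].
    apply: (@continuous_comp _ _ _ (fun y => (y, x3)) f); last exact: cf.
    exact: pair_continuousl.
  by apply: f0 => -[].
by apply: (etrans (esym (integral12_prod_meas1 i2))); apply: integral0_eq => x1 _; exact: i0.
Qed.

Lemma integral3_eq0_x1 (f : R * R * R -> R) (L : R) : continuous f ->
  (forall x, ~ cube L x -> f x = 0) ->
  (forall x2 x3, (\int[lam]_s (f (s, x2, x3))%:E = 0)%E) ->
  (\int[vol3]_x (f x)%:E = 0)%E.
Proof.
move=> cf f0 i0; apply: (etrans (esym (integral21_prod_meas1 (integrable3_cube cf f0)))).
apply: integral0_eq => x3 _; rewrite /fubini_G/=.
have i2 : vol2.-integrable [set: R * R] (EFin \o (fun y => f (y, x3))).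
  apply: (@integrable2_cube _ L) => [y|y yL].
    apply: (@continuous_comp _ _ _ (fun y => (y, x3)) f); last exact: cf.
    exact: pair_continuousl.
  by apply: f0 => -[].
by apply: (etrans (esym (integral21_prod_meas1 i2))); apply: integral0_eq => x2 _; exact: i0.
Qed.

(** The complement of the open interval contains the endpoints, so both boundary terms of the
    fundamental theorem of calculus on [[-L, L]] are zero. *)
Lemma integral_derive_compact_support (G g : R -> R) (L : R) : 0 < L ->
  (forall s, is_derive s (1 : R) G (g s)) -> continuous g ->
  (forall s, s \notin `]- L, L[ -> G s = 0 /\ g s = 0) ->
  (\int[lam]_s (g s)%:E = 0)%E.
Proof.
move=> L0 dG cg out.
have LL : - L < L by lra.
transitivity (\int[lam]_(s in `[(- L)%R, L]) (g s)%:E)%E.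
  rewrite [RHS]integral_mkcond; apply: eq_integral => s _; rewrite patchE.
  case: ifPn => //; rewrite notin_setE/= in_itv/= => /negP sL; congr EFin.
  by apply: (out s _).2; rewrite in_itv/=; apply: contra sL => /andP[/ltW-> /ltW->].
have cG : continuous G.
  by move=> s; apply/differentiable_continuous/derivable1_diffP; exact: (@ex_derive _ _ _ _ _ _ _ (dG s)).
rewrite (@continuous_FTC2 _ g G)//.
- by rewrite !(out _ _).1 ?sube0// in_itv/= ltxx ?andbF.
- exact: continuous_subspaceT.
- split.
  + by move=> x _; exact: (@ex_derive _ _ _ _ _ _ _ (dG x)).
  + exact/cvg_at_right_filter/cG.
  + exact/cvg_at_left_filter/cG.
- by move=> x _; rewrite derive1E; exact: (@derive_val _ _ _ _ _ _ _ (dG x)).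
Qed.

(** Since [b < t1], the set [[t0, b]] times the cube is a compact part of the slab, and [f] is
    bounded there whatever happens near [t1]. *)
Lemma integrable4_cube (t0 t1 b L : R) (f : R * (R * R * R) -> R) :
  b < t1 -> {within slab t0 t1, continuous f} ->
  (forall z, slab t0 t1 z -> ~ cube L z.2 -> f z = 0) ->
  vol4.-integrable (`[t0, b]%classic `*` [set: R * R * R]) (EFin \o f).
Proof.
move=> bt1 cf f0.
have sub : `[t0, b]%classic `*` [set: R * R * R] `<=` slab t0 t1.
  by move=> [t x] [/= + _]; rewrite /slab /= !in_itv/= => /andP[-> /le_lt_trans->].
have cK : compact (`[t0, b]%classic `*` cube L).
  by apply: compact_setX; [exact: segment_compact|exact: compact_cube].
have [|C fC] := compact_continuous_bounded cK (continuous_subspaceW _ cf).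
  by apply: (subset_trans _ sub) => -[t x] [].
have m1 : measurable (`[t0, b]%classic : set R) := measurable_itv _.
apply: (@integrable_bounded_support _ _ R vol4 _ (`[t0, b]%classic `*` cube L) f C) => //.
- exact: measurableX.
- by apply: measurableX => //; exact: measurable_cube.
- apply: product_measure_lty => //; first exact: measurable_cube.
    exact: lebesgue_segment_lty.
  exact: lebesgue3_cube_fin.
- apply: measurable_funS sub _.
    by apply: measurableX => //; exact: measurable_itv.
  exact: within_continuous_measurable_slab.
- by move=> x _; exact: fC.
- by move=> [t x] tb nK; apply: f0 => [|/= xL]; [exact: sub|apply: nK; split; [case: tb|]].
Qed.

(** Fubini with time innermost, then the fundamental theorem on [[t0, b]]. The derivative is asked
    for at interior times only; continuity of [G] and [g] on the slab covers [t0]. *)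
Lemma integral4_dt (t0 t1 b L : R) (G g : R * (R * R * R) -> R) :
  t0 < b -> b < t1 ->
  {within slab t0 t1, continuous g} -> {within slab t0 t1, continuous G} ->
  (forall z, slab t0 t1 z -> ~ cube L z.2 -> g z = 0 /\ G z = 0) ->
  (forall t x, t0 < t < t1 -> is_derive t (1 : R) (fun s => G (s, x)) (g (t, x))) ->
  (\int[vol4]_(z in `[t0, b]%classic `*` [set: R * R * R]) (g z)%:E =
   \int[vol3]_x (G (b, x))%:E - \int[vol3]_x (G (t0, x))%:E)%E.
Proof.
move=> t0b bt1 cg cG out dG.
have m1 : measurable (`[t0, b]%classic `*` [set: R * R * R]).
  by apply: measurableX => //; exact: measurable_itv.
have gi : vol4.-integrable (`[t0, b]%classic `*` [set: R * R * R]) (EFin \o g).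
  by apply: (@integrable4_cube t0 t1 b L) => // z /out h /h[].
rewrite integral_mkcond.
have gi' := (@integrable_mkcond _ _ R vol4 _ (EFin \o g) m1).1 gi.
apply: (etrans (esym (@integral21_prod_meas1 _ _ _ _ R lam vol3 _ gi'))).
rewrite -integralB_EFin//.
- apply: eq_integral => x _; rewrite /fubini_G.
  transitivity (\int[lam]_(t in `[t0, b]) (g (t, x))%:E)%E.
    rewrite [RHS]integral_mkcond; apply: eq_integral => t _; rewrite !patchE.
    by congr (if _ then _ else _); apply/idP/idP; rewrite !inE/=; [case|].
  have cGx := within_slice_continuous cG (x:=x).
  have sub : (`[t0, b] : set R) `<=` `[t0, t1[.
    by move=> t /=; rewrite !in_itv/= => /andP[-> /le_lt_trans->].
  have cGb := continuous_subspaceW sub cGx.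
  rewrite (@continuous_FTC2 _ (fun t => g (t, x)) (fun t => G (t, x)))//.
  + exact: continuous_subspaceW (within_slice_continuous cg (x:=x)).
  + have /(continuous_within_itvP _ t0b)[_ ? ?] := cGb.
    split=> // t; rewrite in_itv/= => /andP[t0t tb].
    by have := dG t x; rewrite t0t (lt_trans tb)// => /(_ isT) h; exact: ex_derive.
  + move=> t; rewrite in_itv/= => /andP[t0t tb]; rewrite derive1E.
    by have := dG t x; rewrite t0t (lt_trans tb)// => /(_ isT) h; exact: derive_val.
- have tb : (`[t0, t1[%classic : set R) b by rewrite /= in_itv/= bt1 ltW.
  apply: (@integrable3_cube _ L) => [|x]; first exact: slice_continuous cG.
  by have /(_ (conj tb I)) h := out (b, x); move=> /h[].
- have tt : (`[t0, t1[%classic : set R) t0 by rewrite /= in_itv/= lexx (lt_trans t0b).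
  apply: (@integrable3_cube _ L) => [|x]; first exact: slice_continuous cG.
  by have /(_ (conj tt I)) h := out (t0, x); move=> /h[].
Qed.

Lemma integral4_eq0 (t0 t1 b L : R) (g : R * (R * R * R) -> R) :
  b < t1 -> {within slab t0 t1, continuous g} ->
  (forall z, slab t0 t1 z -> ~ cube L z.2 -> g z = 0) ->
  (forall t, t0 <= t < t1 -> (\int[vol3]_x (g (t, x))%:E = 0)%E) ->
  (\int[vol4]_(z in `[t0, b]%classic `*` [set: R * R * R]) (g z)%:E = 0)%E.
Proof.
move=> bt1 cg out i0.
have m1 : measurable (`[t0, b]%classic `*` [set: R * R * R]).
  by apply: measurableX => //; exact: measurable_itv.
have gi := integrable4_cube bt1 cg out.
have gi' := (@integrable_mkcond _ _ R vol4 _ (EFin \o g) m1).1 gi.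
rewrite integral_mkcond; apply: (etrans (esym (@integral12_prod_meas1 _ _ _ _ R lam vol3 _ gi'))).
apply: integral0_eq => t _; rewrite /fubini_F.
have [/set_mem|tb] := boolP (t \in (`[t0, b]%classic : set R)).
  rewrite /= in_itv/= => /andP[t0t tb].
  rewrite -[RHS](i0 t) ?t0t ?(le_lt_trans tb)//; apply: eq_integral => x _.
  by rewrite patchE mem_set//=; split => //; rewrite in_itv/= t0t.
apply: integral0_eq => x _; rewrite patchE memNset// => -[/= tb' _].
by move/negP : tb; apply; exact/mem_set.
Qed.

End lebesgue3.

(** * Partial derivatives in the slab *)

Lemma within_near (T : Type) (F : set_system T) (A : set T) :
  Filter F -> F A -> within A F = F.
Proof.
move=> FF FA; apply/seteqP; split=> P; rewrite /within/=.
  by move=> AP; apply: filterS (filterI FA AP) => x [Ax]; exact.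
by apply: filterS => x Px _.
Qed.

Lemma derivable_in_is_derive (R : realType) (V : normedModType R) (D : set V)
    (f : V -> R) (a v : V) :
  (\forall h \near (0 : R)^', D (h *: v + a)) -> derivable_in D f a v ->
  is_derive a v f (derive_in D f a v).
Proof. by move=> nD; rewrite /derivable_in /derive_in within_near. Qed.

Lemma is_derive_line (R : realType) (V : normedModType R) (f : V -> R)
    (a v : V) (s df : R) :
  is_derive (s *: v + a) v f df -> is_derive s (1 : R) (fun h => f (h *: v + a)) df.
Proof.
have E : (fun h : R => h^-1 *: (((fun h => f (h *: v + a)) \o shift s) (h *: 1)
    - f (s *: v + a))) =
  (fun h : R => h^-1 *: ((f \o shift (s *: v + a)) (h *: v) - f (s *: v + a))).
  apply/funext => h /=; rewrite /shift/=; congr (_ *: (f _ - _)).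
  by rewrite addrA -scalerDl; congr (_ *: _ + _); rewrite /GRing.scale/= mulr1.
by case=> d1 d2; split; [rewrite /derivable E|rewrite /derive E].
Qed.

Section slab_calculus.
Context (R : realType) (t0 t1 : R).
Local Notation pt := (R * (R * R * R))%type.
Local Notation D := (slab t0 t1).
Local Notation e mu := (coord_vec R mu).

Lemma coord_vec1 (mu : 'I_4) (h : R) (z : pt) :
  (h *: e mu + z).1 = h * (mu == ord0)%:R + z.1.
Proof. by []. Qed.

Lemma slabP (z : pt) : D z <-> t0 <= z.1 < t1.
Proof. by rewrite /slab/= in_itv/=; split=> [[]|]. Qed.

(** Times met in a coordinate rectangle: a positive step [k] in the time direction leaves the
    initial surface, whether or not ([b]) the other side of the rectangle also points in time. *)
Lemma lt_shift_coord (b : bool) (a h k : R) : t0 <= a -> 0 <= h -> 0 < k ->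
  t0 < k * 1 + (h * b%:R + a).
Proof. by case: b; rewrite /= ?mulr1 ?mulr0; lra. Qed.

(** Only the time direction at the initial time can leave the slab under small increments of both
    signs; everywhere else [derive_in] is the ordinary derivative. *)
Lemma slab_near (mu : 'I_4) (z : pt) : D z -> (mu == ord0 -> t0 < z.1) ->
  \forall h \near (0 : R)^', D (h *: e mu + z).
Proof.
move=> /slabP/andP[t0z zt1] it.
have [m0|m0] := eqVneq mu ord0; last first.
  by near=> h; apply/slabP; rewrite coord_vec1 (negbTE m0) mulr0 add0r t0z.
have {it}t0z' : t0 < z.1 by apply: it; rewrite m0.
near=> h; apply/slabP; rewrite coord_vec1 m0 eqxx mulr1.
have : `|h| < Num.min (z.1 - t0) (t1 - z.1).
  near: h; apply: dnbhs0_lt; rewrite lt_min !subr_gt0 t0z'//.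
by rewrite lt_min !ltr_norml => /andP[/andP[? ?] /andP[? ?]]; lra.
Unshelve. all: by end_near. Qed.

Lemma is_derive_partial (mu : 'I_4) (f : pt -> R) (z : pt) (s : R) :
  C1_in D f -> D (s *: e mu + z) -> (mu == ord0 -> t0 < (s *: e mu + z).1) ->
  is_derive s (1 : R) (fun h => f (h *: e mu + z)) (partial D mu f (s *: e mu + z)).
Proof.
move=> [_ C1f] Dz iz; apply: is_derive_line; apply: derivable_in_is_derive.
  exact: slab_near.
by have [+ _] := C1f mu; apply.
Qed.

Lemma is_derive_dt (f : pt -> R) (t : R) (x : R * R * R) : C1_in D f ->
  t0 < t < t1 -> is_derive t (1 : R) (fun s => f (s, x)) (dt D f (t, x)).
Proof.
move=> C1f /andP[t0t tt1].
have E s : s *: e ord0 + (0, x) = (s, x).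
  case: x => -[x1 x2] x3; rewrite /coord_vec/= /GRing.scale/=.
  by congr (_, (_, _, _)); rewrite /= /GRing.scale/= ?mulr1 ?mulr0 ?addr0 ?add0r.
have := @is_derive_partial ord0 f (0, x) t C1f.
rewrite E => h; have : D (t, x) by apply/slabP; rewrite /= (ltW t0t).
move=> /h /(_ (fun=> t0t)); rewrite [X in is_derive _ _ X _](_ : _ = fun s => f (s, x))//.
by apply/funext => s; rewrite E.
Qed.

(** Unlike the time derivative, this is available at [t = t0] as well, because the line stays in the
    slab. *)
Lemma is_derive_dx1 (f : pt -> R) (t s x2 x3 : R) : C1_in D f -> t0 <= t < t1 ->
  is_derive s (1 : R) (fun s => f (t, (s, x2, x3))) (dx D 0 f (t, (s, x2, x3))).
Proof.
move=> C1f tt.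
have E r : r *: e (lift ord0 0) + (t, (0, x2, x3)) = (t, (r, x2, x3)).
  rewrite /coord_vec/= /GRing.scale/=.
  by congr (_, (_, _, _)); rewrite /= /GRing.scale/= ?mulr1 ?mulr0 ?addr0 ?add0r.
have := @is_derive_partial (lift ord0 0) f (t, (0, x2, x3)) s C1f.
rewrite E => h; have : D (t, (s, x2, x3)) by apply/slabP.
move=> /h {}h; have {}h := h (fun F => ltac:(by [])).
move: h; rewrite [X in is_derive _ _ X _](_ : _ = fun r => f (t, (r, x2, x3)))//.
by apply/funext => r; rewrite E.
Qed.

Lemma is_derive_dx2 (f : pt -> R) (t x1 s x3 : R) : C1_in D f -> t0 <= t < t1 ->
  is_derive s (1 : R) (fun s => f (t, (x1, s, x3))) (dx D 1 f (t, (x1, s, x3))).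
Proof.
move=> C1f tt.
have E r : r *: e (lift ord0 1) + (t, (x1, 0, x3)) = (t, (x1, r, x3)).
  rewrite /coord_vec/= /GRing.scale/=.
  by congr (_, (_, _, _)); rewrite /= /GRing.scale/= ?mulr1 ?mulr0 ?addr0 ?add0r.
have := @is_derive_partial (lift ord0 1) f (t, (x1, 0, x3)) s C1f.
rewrite E => h; have : D (t, (x1, s, x3)) by apply/slabP.
move=> /h {}h; have {}h := h (fun F => ltac:(by [])).
move: h; rewrite [X in is_derive _ _ X _](_ : _ = fun r => f (t, (x1, r, x3)))//.
by apply/funext => r; rewrite E.
Qed.

Lemma is_derive_dx3 (f : pt -> R) (t x1 x2 s : R) : C1_in D f -> t0 <= t < t1 ->
  is_derive s (1 : R) (fun s => f (t, (x1, x2, s))) (dx D 2 f (t, (x1, x2, s))).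
Proof.
move=> C1f tt.
have E r : r *: e (lift ord0 2) + (t, (x1, x2, 0)) = (t, (x1, x2, r)).
  rewrite /coord_vec/= /GRing.scale/=.
  by congr (_, (_, _, _)); rewrite /= /GRing.scale/= ?mulr1 ?mulr0 ?addr0 ?add0r.
have := @is_derive_partial (lift ord0 2) f (t, (x1, x2, 0)) s C1f.
rewrite E => h; have : D (t, (x1, x2, s)) by apply/slabP.
move=> /h {}h; have {}h := h (fun F => ltac:(by [])).
move: h; rewrite [X in is_derive _ _ X _](_ : _ = fun r => f (t, (x1, x2, r)))//.
by apply/funext => r; rewrite E.
Qed.

(** * Equality of mixed second derivatives, up to the initial time *)

Lemma within_line_continuous (f : pt -> R) (v z : pt) (r : R) :
  {within D, continuous f} -> (forall s, s \in `[0, r] -> D (s *: v + z)) ->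
  {within `[0, r], continuous (fun s => f (s *: v + z))}.
Proof.
move=> /subspace_continuousP cf sD; apply/subspace_continuousP => s sr.
apply: (@cvg_comp _ _ _ (fun h => h *: v + z) f _ _ _ _ (cf _ (sD s sr))).
have cl : (h *: v + z) @[h --> s] --> (s *: v + z).
  exact: (cvgD (cvgZr_tmp cvg_id) (cvg_cst z)).
move=> P /= wP; apply: (@filterS _ (nbhs s) _ _ _ _ (cl _ wP)) => h DP hr.
by apply: DP; exact: sD.
Qed.

(** The mean value theorem applied twice to the second difference, first along [mu] and then along
    [nu]. The corner [a] may lie on the initial surface, since the rectangle extends only in the
    positive directions. The time [a.1 + r + r] is reached when both directions are the time
    direction. *)
Lemma rectangle_mvt (mu nu : 'I_4) (f : pt -> R) (a : pt) (r : R) :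
  C2_in D f -> D a -> 0 < r -> a.1 + r + r < t1 ->
  let P h k := h *: e mu + (k *: e nu + a) in
  exists c d, [/\ 0 < c < r, 0 < d < r &
    f (P r r) - f (P 0 r) - f (P r 0) + f (P 0 0) =
    r * r * partial D nu (partial D mu f) (P c d)].
Proof.
have E4 (x y z w : R) : x - y - z + w = x - z - (y - w) by ring.
have E3 (x y : R) : x * y * y = y * y * x by ring.
move=> [C1f C1df] Da r0 ar P; have /slabP/andP[t0a at1] := Da.
have P1 h k : (P h k).1 = h * (mu == ord0)%:R + (k * (nu == ord0)%:R + a.1) by [].
have DP h k : 0 <= h <= r -> 0 <= k <= r -> D (P h k).
  move=> /andP[h0 hr] /andP[k0 kr]; apply/slabP; rewrite P1.
  by case: (mu == ord0); case: (nu == ord0); rewrite /= ?mulr1 ?mulr0; lra.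
have PC h k : P h k = k *: e nu + (h *: e mu + a) by rewrite /P addrCA.
have zr : 0 <= (0 : R) <= r by rewrite lexx ltW.
have rr : 0 <= r <= r by rewrite lexx ltW.
have oc h : h \in `]0, r[ -> 0 <= h <= r.
  by rewrite in_itv/= => /andP[h0 hr]; rewrite !ltW.
have [| |c cr Ec] := @MVT _ (fun h => f (P h r) - f (P h 0))
    (fun h => partial D mu f (P h r) - partial D mu f (P h 0)) 0 r r0.
- move=> h hr; have hr' := oc _ hr; move: hr; rewrite in_itv/= => /andP[h0 hr].
  apply: is_deriveB; apply: is_derive_partial => //; try exact: DP;
  by move=> /eqP m0; rewrite !coord_vec1 m0 eqxx; apply: lt_shift_coord => //; rewrite ltW.
- have ck k : 0 <= k <= r -> {within `[0, r], continuous (fun h => f (P h k))}.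
    move=> k0; apply: within_line_continuous; first exact: (proj1 C1f).
    by move=> s; rewrite in_itv/= => s0; exact: DP.
  by move=> s; apply: continuousB; [exact: (ck r rr s)|exact: (ck 0 zr s)].
have cr' := oc _ cr; move: (cr); rewrite in_itv/= => cr''.
have [| |d dr Ed] := @MVT _ (fun k => partial D mu f (P c k))
    (fun k => partial D nu (partial D mu f) (P c k)) 0 r r0.
- move=> k kr; have kr' := oc _ kr; move: kr; rewrite in_itv/= => /andP[k0 kr].
  rewrite [X in is_derive _ _ X _](_ : _ = fun k =>
    partial D mu f (k *: e nu + (c *: e mu + a))); last by apply/funext => l; rewrite PC.
  rewrite PC; apply: is_derive_partial; first exact: C1df.
    by rewrite -PC; exact: DP.
  by move=> /eqP m0; rewrite !coord_vec1 m0 eqxx; apply: lt_shift_coord; case/andP: cr'.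
- rewrite (_ : (fun k => _) = fun k =>
    partial D mu f (k *: e nu + (c *: e mu + a))); last by apply/funext => l; rewrite PC.
  apply: within_line_continuous; first exact: (proj1 (C1df mu)).
  by move=> s; rewrite in_itv/= => s0; rewrite -PC; apply: DP.
exists c, d; split => //.
by rewrite E4 Ec Ed !subr0 E3.
Qed.

(** The second difference over a rectangle is symmetric in [mu] and [nu], so the two mixed
    derivatives agree at some pair of points near [a]. Both are continuous on the slab, and
    shrinking the rectangle gives equality at [a], boundary points included. *)
Lemma partialC (mu nu : 'I_4) (f : pt -> R) (a : pt) : C2_in D f -> D a ->
  partial D nu (partial D mu f) a = partial D mu (partial D nu f) a.
Proof.
have E4 (x y z w : R) : x - y - z + w = x - z - y + w by ring.
have E5 (x y z : R) : x - y = (x - z) - (y - z) by ring.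
move=> C2f Da; have /slabP/andP[t0a at1] := Da.
have [_ C1df] := C2f.
have cA := ((C1df mu).2 nu).2; have cB := ((C1df nu).2 mu).2.
set A := partial D nu (partial D mu f) in cA *.
set B := partial D mu (partial D nu f) in cB *.
move/subspace_continuousP/(_ a Da)/cvgrPdist_lt : cA => cA.
move/subspace_continuousP/(_ a Da)/cvgrPdist_lt : cB => cB.
apply/eqP; rewrite -subr_eq0 -normr_le0; apply/ler_addgt0Pr => eps eps0; rewrite add0r.
have e2 : 0 < eps / 2 by rewrite divr_gt0.
have : nbhs a [set y | D y -> `|A a - A y| < eps / 2 /\ `|B a - B y| < eps / 2].
  exact: (filterI (cA _ e2) (cB _ e2)).
move=> /nbhs_ballP[d /= d0 dP].
have norm_e nu' (h : R) : `|h *: e nu'| <= `|h|.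
  rewrite normrZ ler_piMr// /coord_vec.
  by rewrite /Num.norm/= /Num.norm/= !ge_max !normr_nat; case: nu' => -[|[|[|[|]]]]//= _; rewrite ?ler01 ?lexx.
(* Two steps of length less than [r] have total norm below [2 d / 3], and move time by less than two
   thirds of the distance to [t1]. *)
pose r := Num.min (d / 3) ((t1 - a.1) / 3).
have r0 : 0 < r by rewrite lt_min !divr_gt0// subr_gt0.
have rd : r <= d / 3 by rewrite ge_min lexx.
have rt : r <= (t1 - a.1) / 3 by rewrite ge_min lexx orbT.
have ar : a.1 + r + r < t1 by lra.
have inP m n h k : 0 < h < r -> 0 < k < r ->
    ball a d (h *: e m + (k *: e n + a)) /\ D (h *: e m + (k *: e n + a)).
  move=> /andP[h0 hr] /andP[k0 kr]; split.
    rewrite -ball_normE /ball_/= addrA opprD addrCA subrr addr0 normrN.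
    rewrite (le_lt_trans (ler_normD _ _))//.
    have := norm_e m h; have := norm_e n k; rewrite !gtr0_norm//; lra.
  apply/slabP; rewrite !coord_vec1.
  by case: (m == ord0); case: (n == ord0); rewrite /= ?mulr1 ?mulr0; lra.
have [c1 [k1 [c1r k1r E1]]] := rectangle_mvt mu nu C2f Da r0 ar.
have [c2 [k2 [c2r k2r E2]]] := rectangle_mvt nu mu C2f Da r0 ar.
rewrite -/A in E1; rewrite -/B in E2; clearbody A B.
have EE : A (c1 *: e mu + (k1 *: e nu + a)) = B (c2 *: e nu + (k2 *: e mu + a)).
  have rr : r * r != 0 by rewrite mulf_neq0// gt_eqF.
  apply: (mulfI rr); rewrite -E1 -E2.
  by rewrite !scale0r !add0r [r *: e mu + (_ + _)]addrCA E4.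
have [b1 D1] := inP mu nu _ _ c1r k1r; have [b2 D2] := inP nu mu _ _ c2r k2r.
have [A1 _] := dP _ b1 D1; have [_ B2] := dP _ b2 D2.
rewrite (E5 _ _ (A (c1 *: e mu + (k1 *: e nu + a)))) {2}EE.
by rewrite (le_trans (ler_normB _ _))// [eps]splitr lerD// ltW.
Qed.

End slab_calculus.

(** * One-variable derivatives and the pointwise energy inequality *)

Lemma is_derive_mul (R : realType) (f g : R -> R) (x df dg : R) :
  is_derive x (1 : R) f df -> is_derive x (1 : R) g dg ->
  is_derive x (1 : R) (fun s => f s * g s) (f x * dg + g x * df).
Proof. by move=> hf hg; have := is_deriveM hf hg. Qed.

Lemma is_derive_add (R : realType) (f g : R -> R) (x df dg : R) :
  is_derive x (1 : R) f df -> is_derive x (1 : R) g dg ->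
  is_derive x (1 : R) (fun s => f s + g s) (df + dg).
Proof. by move=> hf hg; have := is_deriveD hf hg. Qed.

Lemma is_derive_sqr (R : realType) (f : R -> R) (x df : R) :
  is_derive x (1 : R) f df -> is_derive x (1 : R) (fun s => f s ^+ 2) (2 * f x * df).
Proof.
move=> hf; have h := is_derive_mul hf hf.
by apply: (is_derive_eq h); ring.
Qed.

(** The Taylor remainder is at most [h^2] in absolute value, by cases on the signs of [y] and
    [h + y]. This also covers the kink [y = 0]. *)
Lemma is_derive_sqr_pos (R : realType) (y : R) :
  is_derive y (1 : R) (fun y => Num.max y 0 ^+ 2) (2 * Num.max y 0).
Proof.
have cv : (fun h : R => h^-1 *: (((fun y => Num.max y 0 ^+ 2) \o shift y) (h *: (1 : R))
     - Num.max y 0 ^+ 2)) @ 0^' --> 2 * Num.max y 0.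
  apply/cvgrPdist_le => eps e0; near=> h.
  have h0 : h != 0 by near: h; exact: nbhs_dnbhs_neq.
  have he : `|h| <= eps by near: h; exact: dnbhs0_le.
  rewrite /= /shift/= /GRing.scale/= mulr1 (le_trans _ he)//.
  rewrite -(ler_pM2l (_ : 0 < `|h|)) ?normr_gt0// -normrM mulrBr mulVKf// -expr2.
  rewrite real_normK ?num_real// ler_norml.
  by case: (leP y 0) => y0; case: (leP (h + y) 0) => hy0; apply/andP; split; nra.
by split; [apply/cvg_ex; eexists; exact: cv|exact: (cvg_lim _ cv)].
Unshelve. all: by end_near. Qed.

Lemma is_derive_sqr_pos_comp (R : realType) (q : R -> R) (s dq : R) :
  is_derive s (1 : R) q dq ->
  is_derive s (1 : R) (fun s => Num.max (q s) 0 ^+ 2) (2 * Num.max (q s) 0 * dq).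
Proof.
move=> hq.
have h := @is_derive1_comp _ (fun y => Num.max y 0 ^+ 2) q s _ _ (is_derive_sqr_pos (q s)) hq.
by apply: (is_derive_eq h); rewrite /GRing.scale/=.
Qed.

(* After the wave equation is used to eliminate [psit], the right-hand side
   minus the left-hand side is a positive multiple of [(t F + 2 p psi)^2] plus
   the flux term, which is nonnegative because [K] bounds the speed [t^-p]. *)
Lemma energy_density_ineq (R : realType)
    (p t a K G w psi psit c1 c2 c3 m1 m2 m3 n1 n2 n3 l1 l2 l3 y1 y2 y3 F : R) :
  0 < p -> 0 < t -> 0 < a -> 1 <= K -> 1 <= K * a -> 0 <= G -> 0 <= w ->
  (0 < G -> y1 ^+ 2 + y2 ^+ 2 + y3 ^+ 2 <= 1) ->
  F = - psit - 3 * p / t * psi + a^-1 * (l1 + l2 + l3) ->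
  n1 = m1 -> n2 = m2 -> n3 = m3 ->
  - K * G * (2^-1 * (a * psi ^+ 2 + (c1 ^+ 2 + c2 ^+ 2 + c3 ^+ 2)))
   + w * (2^-1 * (2 * p * a / t * psi ^+ 2 + a * (2 * psi * psit)
     + (2 * c1 * m1 + 2 * c2 * m2 + 2 * c3 * m3)))
   + p * (w * (a / t * psi ^+ 2))
  <= (4 * p)^-1 * (w * (a * t * F ^+ 2))
   + (- G * y1 * (psi * c1) + w * (n1 * c1 + psi * l1))
   + (- G * y2 * (psi * c2) + w * (n2 * c2 + psi * l2))
   + (- G * y3 * (psi * c3) + w * (n3 * c3 + psi * l3)).
Proof.
move=> p0 t0 a0 K1 Ka G0 w0 y1P FE -> -> ->.
have psitE : psit = - F - 3 * p / t * psi + a^-1 * (l1 + l2 + l3) by rewrite FE; ring.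
rewrite -subr_ge0.
rewrite [X in 0 <= X](_ : _ = w * a / (4 * p * t) * (t * F + 2 * p * psi) ^+ 2
  + (K * G * (2^-1 * (a * psi ^+ 2 + (c1 ^+ 2 + c2 ^+ 2 + c3 ^+ 2)))
     - G * psi * (y1 * c1 + y2 * c2 + y3 * c3))); last first.
  by rewrite psitE; field; rewrite !gt_eqF.
apply: addr_ge0.
  by rewrite mulr_ge0 ?sqr_ge0// divr_ge0 ?mulr_ge0// ltW// !mulr_gt0.
(* The bound on [y] is available only where [G > 0]; where [G = 0] the flux term vanishes. Otherwise
   [2 psi (y . c) <= |c|^2 + psi^2 |y|^2 <= |c|^2 + psi^2], which [K >= 1] and [K a >= 1] absorb. *)
have [->|Gn0] := eqVneq G 0; first by rewrite !(mulr0, mul0r) subr0.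
have Gp : 0 < G by rewrite lt_neqAle eq_sym Gn0.
have {}y1P := y1P Gp.
have h1 : (psi ^+ 2 + (c1 ^+ 2 + c2 ^+ 2 + c3 ^+ 2))
    <= K * (a * psi ^+ 2 + (c1 ^+ 2 + c2 ^+ 2 + c3 ^+ 2)).
  rewrite mulrDr mulrA lerD// ler_peMl ?sqr_ge0 ?addr_ge0 ?sqr_ge0//.
have h2 : 0 <= psi ^+ 2 * (1 - (y1 ^+ 2 + y2 ^+ 2 + y3 ^+ 2)).
  by rewrite mulr_ge0 ?sqr_ge0// subr_ge0.
have h3 : 0 <= (c1 - psi * y1) ^+ 2 + (c2 - psi * y2) ^+ 2 + (c3 - psi * y3) ^+ 2.
  by rewrite !addr_ge0 ?sqr_ge0.
have -> : K * G * (2^-1 * (a * psi ^+ 2 + (c1 ^+ 2 + c2 ^+ 2 + c3 ^+ 2)))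
     - G * psi * (y1 * c1 + y2 * c2 + y3 * c3) = G * 2^-1 *
   (K * (a * psi ^+ 2 + (c1 ^+ 2 + c2 ^+ 2 + c3 ^+ 2))
     - 2 * psi * (y1 * c1 + y2 * c2 + y3 * c3)) by field.
apply: mulr_ge0; first by rewrite divr_ge0// ltW.
rewrite subr_ge0 (le_trans _ h1)//; nra.
Qed.

(** Here [at'] stands for [t^(2p-1)], so [2 * p * at'] is the derivative of [a = t^(2p)]. The
    summand multiplied by [0] is what the product rule leaves for the constant factor one half. *)
Lemma dt_energy_algebra (R : realType) (p t a at' K G : R) : at' = a / t ->
  forall w psi psit c1 c2 c3 m1 m2 m3 : R,
  w * (2^-1 * (a * (2 * psi * psit) + psi ^+ 2 * (2 * p * at')
         + (2 * c1 * m1 + 2 * c2 * m2 + 2 * c3 * m3))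
       + (a * psi ^+ 2 + (c1 ^+ 2 + c2 ^+ 2 + c3 ^+ 2)) * 0)
    + 2^-1 * (a * psi ^+ 2 + (c1 ^+ 2 + c2 ^+ 2 + c3 ^+ 2)) * (- K * G)
  = - K * G * (2^-1 * (a * psi ^+ 2 + (c1 ^+ 2 + c2 ^+ 2 + c3 ^+ 2)))
    + w * (2^-1 * (2 * p * a / t * psi ^+ 2 + a * (2 * psi * psit)
       + (2 * c1 * m1 + 2 * c2 * m2 + 2 * c3 * m3))).
Proof. by move=> -> *; ring. Qed.

Lemma dx_flux_algebra (R : realType) (w psi c n l g : R) :
  w * (psi * l + c * n) + psi * c * g = g * (psi * c) + w * (n * c + psi * l).
Proof. by ring. Qed.

(** * The weight *)

Section within_continuous_arith.
Context (T : topologicalType) (R : realType) (A : set T).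
Implicit Types f g : T -> R.

Lemma within_continuousD f g : {within A, continuous f} ->
  {within A, continuous g} -> {within A, continuous (fun x => f x + g x)}.
Proof. by move=> cf cg x; apply: continuousD; [exact: cf|exact: cg]. Qed.

Lemma within_continuousM f g : {within A, continuous f} ->
  {within A, continuous g} -> {within A, continuous (fun x => f x * g x)}.
Proof. by move=> cf cg x; apply: continuousM; [exact: cf|exact: cg]. Qed.

Lemma within_continuousN f : {within A, continuous f} ->
  {within A, continuous (fun x => - f x)}.
Proof. by move=> cf x; apply: continuousN; exact: cf. Qed.

Lemma within_continuousX2 f : {within A, continuous f} ->
  {within A, continuous (fun x => f x ^+ 2)}.
Proof. by move=> cf; exact: within_continuousM. Qed.

Lemma within_continuous_cst (c : R) : {within A, continuous (fun=> c : R)}.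
Proof. by move=> x; exact: cvg_cst. Qed.

End within_continuous_arith.

Lemma sum3E (R : realType) (F : 'I_3 -> R) : \sum_(i < 3) F i = F 0 + F 1 + F 2.
Proof.
rewrite !big_ord_recl big_ord0 addr0 addrA.
by congr (_ + F _ + F _); apply/val_inj.
Qed.

Lemma is_derive_quadratic (R : realType) (c b d s : R) :
  is_derive s (1 : R) (fun s => c + (b * s + d * s ^+ 2)) (b + d * (2 * s)).
Proof.
have hid := is_derive_id s (1 : R).
have h1 := is_derive_mul (is_derive_cst b s 1) hid.
have h2 := is_derive_mul (is_derive_cst d s 1) (is_derive_sqr hid).
have h := is_derive_add (is_derive_cst c s 1) (is_derive_add h1 h2).
by apply: (is_derive_eq h); rewrite /cst/= !mulr1 !mulr0 !addr0 add0r.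
Qed.

Section weight.
Context (R : realType) (t0 t1 K eps : R).
Local Notation pt := (R * (R * R * R))%type.
Local Notation D := (slab t0 t1).
Context (K0 : 0 <= K) (eps0 : 0 < eps).

(** Where this is nonnegative and [t >= t0], [eps |x| <= 1], so its spatial gradient has length at
    most [2 eps] while its time derivative is [-2 K eps]: the level sets shrink at speed at least
    [K]. At a fixed point it tends to [1] as [eps] tends to [0]. *)
Definition wgt_arg (z : pt) : R := 1 - 2 * K * eps * (z.1 - t0)
  - eps ^+ 2 * (z.2.1.1 ^+ 2 + z.2.1.2 ^+ 2 + z.2.2 ^+ 2).

(* [max(q, 0)], so that the derivatives of the weight are
   [d_t w = - K G] and [d_i w = - G eps x_i], where [G = 4 eps max(q, 0)]. *)
Definition wgt_pos (z : pt) : R := Num.max (wgt_arg z) 0.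

Definition wgt (z : pt) : R := wgt_pos z ^+ 2.

Lemma wgt_pos_ge0 z : 0 <= wgt_pos z.
Proof. by rewrite /wgt_pos le_max lexx orbT. Qed.

Lemma wgt_ge0 z : 0 <= wgt z.
Proof. exact: sqr_ge0. Qed.

Lemma wgt_le1 z : t0 <= z.1 -> wgt z <= 1.
Proof.
move=> tz; rewrite /wgt expr_le1// ?wgt_pos_ge0// /wgt_pos ge_max ler01 andbT.
rewrite /wgt_arg -addrA gerDl -opprD oppr_le0 addr_ge0//.
  by rewrite mulr_ge0 ?subr_ge0// mulr_ge0 ?(ltW eps0)// mulr_ge0.
by rewrite mulr_ge0 ?addr_ge0 ?sqr_ge0.
Qed.

Lemma wgt_pos_gt0 z : t0 <= z.1 -> 0 < wgt_pos z ->
  (eps * z.2.1.1) ^+ 2 + (eps * z.2.1.2) ^+ 2 + (eps * z.2.2) ^+ 2 <= 1.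
Proof.
move=> tz; rewrite /wgt_pos lt_max ltxx orbF /wgt_arg => h.
have h2 : 0 <= 2 * K * eps * (z.1 - t0).
  by rewrite mulr_ge0 ?subr_ge0// mulr_ge0 ?(ltW eps0)// mulr_ge0.
rewrite !exprMn -!mulrDr; lra.
Qed.

(** One large coordinate suffices, which is the form needed on coordinate lines. The inequalities
    are not strict, so that the weight vanishes at the endpoints of the segments of integration. *)
Lemma wgt_pos_eq0 z : t0 <= z.1 ->
  [|| eps^-1 <= `|z.2.1.1|, eps^-1 <= `|z.2.1.2| | eps^-1 <= `|z.2.2|] ->
  wgt_pos z = 0.
Proof.
move=> tz h; apply/eqP; rewrite eq_le wgt_pos_ge0 andbT /wgt_pos ge_max lexx andbT.
have h2 : 0 <= 2 * K * eps * (z.1 - t0).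
  by rewrite mulr_ge0 ?subr_ge0// mulr_ge0 ?(ltW eps0)// mulr_ge0.
have sq (y : R) : eps^-1 <= `|y| -> 1 <= eps ^+ 2 * y ^+ 2.
  rewrite -exprMn => ey; rewrite -real_normK ?num_real// expr_ge1// normrM gtr0_norm//.
  by rewrite mulrC -ler_pdivrMr// div1r.
have nn (y : R) : 0 <= eps ^+ 2 * y ^+ 2 by rewrite mulr_ge0 ?sqr_ge0.
rewrite /wgt_arg !mulrDr.
have := nn z.2.1.1; have := nn z.2.1.2; have := nn z.2.2.
by case/or3P: h => /sq; lra.
Qed.

Lemma wgt_pos_cube z : t0 <= z.1 -> ~ cube eps^-1 z.2 -> wgt_pos z = 0.
Proof.
move=> tz nc; apply: wgt_pos_eq0 => //; apply/negPn/negP.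
rewrite !negb_or -!ltNge !ltr_norml => /and3P[/andP[? ?] /andP[? ?] /andP[? ?]].
by apply: nc; split; [split|]; rewrite /= in_itv/= !ltW.
Qed.

Lemma wgt_pos_continuous : continuous wgt_pos.
Proof.
have cf1 : continuous (fun z : pt => z.1) by move=> z; exact: cvg_fst.
have cf2 : continuous (fun z : pt => z.2) by move=> z; exact: cvg_snd.
have cx1 : continuous (fun z : pt => z.2.1.1).
  by move=> z; exact: (cvg_comp _ _ (cvg_comp _ _ (cf2 z) cvg_fst) cvg_fst).
have cx2 : continuous (fun z : pt => z.2.1.2).
  by move=> z; exact: (cvg_comp _ _ (cvg_comp _ _ (cf2 z) cvg_fst) cvg_snd).
have cx3 : continuous (fun z : pt => z.2.2).
  by move=> z; exact: (cvg_comp _ _ (cf2 z) cvg_snd).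
have sq (f : pt -> R) : continuous f -> continuous (fun z => f z ^+ 2).
  by move=> cf z; apply: (@continuousM _ _ f f z); exact: cf.
move=> z; apply: (@continuous_max _ _ wgt_arg (cst 0)); last exact: cvg_cst.
apply: continuousB.
  apply: continuousB; first exact: cvg_cst.
  apply: continuousM; first exact: cvg_cst.
  by apply: continuousB; [exact: cf1|exact: cvg_cst].
apply: continuousM; first exact: cvg_cst.
by apply: continuousD; [apply: continuousD|]; apply: sq.
Qed.

Lemma is_derive_wgt_t (t : R) x : is_derive t (1 : R) (fun s => wgt (s, x))
  (- K * (4 * eps * wgt_pos (t, x))).
Proof.
have h : is_derive t (1 : R) (fun s => wgt_arg (s, x)) (- 2 * K * eps).
  rewrite (_ : (fun s => _) = fun s => (1 + 2 * K * eps * t0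
      - eps ^+ 2 * (x.1.1 ^+ 2 + x.1.2 ^+ 2 + x.2 ^+ 2))
      + (- 2 * K * eps * s + 0 * s ^+ 2)).
    by apply: (is_derive_eq (is_derive_quadratic _ _ _ _)); ring.
  by apply/funext => s; rewrite /wgt_arg/=; ring.
by apply: (is_derive_eq (is_derive_sqr_pos_comp h)); rewrite -/(wgt_pos _); ring.
Qed.

Lemma is_derive_wgt_x1 (t s x2 x3 : R) :
  is_derive s (1 : R) (fun s => wgt (t, (s, x2, x3)))
  (- (4 * eps * wgt_pos (t, (s, x2, x3))) * (eps * s)).
Proof.
have h : is_derive s (1 : R) (fun s => wgt_arg (t, (s, x2, x3))) (- 2 * eps ^+ 2 * s).
  rewrite (_ : (fun s => _) = fun s => (1 - 2 * K * eps * (t - t0)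
      - eps ^+ 2 * (x2 ^+ 2 + x3 ^+ 2)) + (0 * s + - eps ^+ 2 * s ^+ 2)).
    by apply: (is_derive_eq (is_derive_quadratic _ _ _ _)); ring.
  by apply/funext => r; rewrite /wgt_arg/=; ring.
by apply: (is_derive_eq (is_derive_sqr_pos_comp h)); rewrite -/(wgt_pos _); ring.
Qed.

Lemma is_derive_wgt_x2 (t x1 s x3 : R) :
  is_derive s (1 : R) (fun s => wgt (t, (x1, s, x3)))
  (- (4 * eps * wgt_pos (t, (x1, s, x3))) * (eps * s)).
Proof.
have h : is_derive s (1 : R) (fun s => wgt_arg (t, (x1, s, x3))) (- 2 * eps ^+ 2 * s).
  rewrite (_ : (fun s => _) = fun s => (1 - 2 * K * eps * (t - t0)
      - eps ^+ 2 * (x1 ^+ 2 + x3 ^+ 2)) + (0 * s + - eps ^+ 2 * s ^+ 2)).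
    by apply: (is_derive_eq (is_derive_quadratic _ _ _ _)); ring.
  by apply/funext => r; rewrite /wgt_arg/=; ring.
by apply: (is_derive_eq (is_derive_sqr_pos_comp h)); rewrite -/(wgt_pos _); ring.
Qed.

Lemma is_derive_wgt_x3 (t x1 x2 s : R) :
  is_derive s (1 : R) (fun s => wgt (t, (x1, x2, s)))
  (- (4 * eps * wgt_pos (t, (x1, x2, s))) * (eps * s)).
Proof.
have h : is_derive s (1 : R) (fun s => wgt_arg (t, (x1, x2, s))) (- 2 * eps ^+ 2 * s).
  rewrite (_ : (fun s => _) = fun s => (1 - 2 * K * eps * (t - t0)
      - eps ^+ 2 * (x1 ^+ 2 + x2 ^+ 2)) + (0 * s + - eps ^+ 2 * s ^+ 2)).
    by apply: (is_derive_eq (is_derive_quadratic _ _ _ _)); ring.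
  by apply/funext => r; rewrite /wgt_arg/=; ring.
by apply: (is_derive_eq (is_derive_sqr_pos_comp h)); rewrite -/(wgt_pos _); ring.
Qed.

End weight.

(** * The weighted energy inequality *)

(* Without this, failing unification problems between distinct partial
   derivatives unfold down to filters. *)
#[local] Opaque partial.
Section weighted_energy.
Context (R : realType) (p t0 t1 K eps : R) (phi : R * (R * R * R) -> R).
Local Notation pt := (R * (R * R * R))%type.
Local Notation D := (slab t0 t1).
Local Notation lam := (@lebesgue_measure R).
Local Notation vol3 := (@vol3 R).
Local Notation vol4 := (@vol4 R).
Local Notation psi := (dt D phi).
Local Notation chi i := (dx D i phi).
Local Notation w := (wgt t0 K eps).
Local Notation G z := (4 * eps * wgt_pos t0 K eps z).
Context (p0 : 0 < p) (t00 : 0 < t0) (eps0 : 0 < eps)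
  (K1 : 1 <= K) (Kt0 : 1 <= K * t0 `^ (2 * p)) (C2phi : C2_in D phi).

Let K0 : 0 <= K. Proof. exact: le_trans K1. Qed.

(** Twice the density [e]; the factor one half is carried separately. *)
Definition energy_density (z : pt) : R := z.1 `^ (2 * p) * psi z ^+ 2
  + (chi 0 z ^+ 2 + chi 1 z ^+ 2 + chi 2 z ^+ 2).

(** The time derivative of [w * e], written out so that it makes sense and is continuous on the
    whole slab, [t = t0] included. *)
Definition dt_energy (z : pt) : R :=
  - K * G z * (2^-1 * energy_density z)
  + w z * (2^-1 * (2 * p * z.1 `^ (2 * p) / z.1 * psi z ^+ 2
     + z.1 `^ (2 * p) * (2 * psi z * dt D psi z)
     + (2 * chi 0 z * dt D (chi 0) z + 2 * chi 1 z * dt D (chi 1) z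
        + 2 * chi 2 z * dt D (chi 2) z))).

(** This is [d_i (w psi chi_i)] when [y] is the coordinate function [x_i]. *)
Definition dx_flux (i : 'I_3) (y : pt -> R) (z : pt) : R :=
  - G z * (eps * y z) * (psi z * chi i z)
  + w z * (dx D i psi z * chi i z + psi z * dx D i (chi i) z).

(** This and [source] are the squares of the integrands of the two spacetime norms, with [t^(2p-1)]
    and [t^(2p+1)] split into [t^(2p)] and a power of [t]. *)
Definition dissipation (z : pt) : R := z.1 `^ (2 * p) / z.1 * psi z ^+ 2.

Definition source (z : pt) : R := z.1 `^ (2 * p) * z.1 * box p D phi z ^+ 2.

Local Notation flux1 := (dx_flux 0 (fun z => z.2.1.1)).
Local Notation flux2 := (dx_flux 1 (fun z => z.2.1.2)).
Local Notation flux3 := (dx_flux 2 (fun z => z.2.2)).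

Lemma C1_dt : C1_in D psi. Proof. by have [_] := C2phi; exact. Qed.

Lemma C1_dx i : C1_in D (chi i). Proof. by have [_] := C2phi; exact. Qed.

Lemma continuous_psi : {within D, continuous psi}.
Proof. by have [] := C1_dt. Qed.

Lemma continuous_chi i : {within D, continuous (chi i)}.
Proof. by have [] := C1_dx i. Qed.

Lemma continuous_partial_dt mu : {within D, continuous (partial D mu psi)}.
Proof. by have [_ /(_ mu)[]] := C1_dt. Qed.

Lemma continuous_partial_dx mu i : {within D, continuous (partial D mu (chi i))}.
Proof. by have [_ /(_ mu)[]] := C1_dx i. Qed.

Lemma within_continuous_time (h : R -> R) :
  (forall t, 0 < t -> {for t, continuous h}) -> {within D, continuous (fun z => h z.1)}.
Proof.
move=> ch; apply/subspace_continuousP => z /slabP/andP[tz _].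
apply: cvg_within_filter.
exact: (cvg_comp _ _ (cvg_fst : fst @ nbhs z --> z.1) (ch z.1 (lt_le_trans t00 tz))).
Qed.

Lemma powR_continuous_at (r t : R) : 0 < t -> {for t, continuous (fun t => t `^ r)}.
Proof.
move=> tp; apply/differentiable_continuous/derivable1_diffP.
exact: (@ex_derive _ _ _ _ _ _ _ (is_derive1_powR r tp)).
Qed.

Lemma continuous_powR (r : R) : {within D, continuous (fun z : pt => z.1 `^ r)}.
Proof.
by apply: (@within_continuous_time (fun t => t `^ r)) => t; exact: powR_continuous_at.
Qed.

Lemma continuous_time : {within D, continuous (fun z : pt => z.1)}.
Proof. by apply: (@within_continuous_time id) => t _; exact: cvg_id. Qed.

Lemma continuous_timeV : {within D, continuous (fun z : pt => z.1^-1)}.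
Proof.
apply: (@within_continuous_time GRing.inv) => t tp.
by apply: (@cvgV _ _ (nbhs t) _ id t) => //; rewrite gt_eqF.
Qed.

Lemma continuous_powRV (r : R) : {within D, continuous (fun z : pt => (z.1 `^ r)^-1)}.
Proof.
apply: (@within_continuous_time (fun t => (t `^ r)^-1)) => t tp.
apply: (@cvgV _ _ (nbhs t)); first by rewrite gt_eqF// powR_gt0.
exact: powR_continuous_at.
Qed.

Lemma continuous_box : {within D, continuous (box p D phi)}.
Proof.
rewrite /box /laplacian.
apply: within_continuousD.
  apply: within_continuousD; first by apply: within_continuousN; exact: continuous_partial_dt.
  apply: within_continuousN; apply: within_continuousM; last exact: continuous_psi.
  by apply: within_continuousM; [exact: within_continuous_cst|exact: continuous_timeV].
apply: within_continuousM; first exact: continuous_powRV.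
rewrite (_ : (fun z => _) = fun z => dx D 0 (chi 0) z + dx D 1 (chi 1) z + dx D 2 (chi 2) z).
  by do 2?[apply: within_continuousD]; exact: continuous_partial_dx.
by apply/funext => z; rewrite sum3E.
Qed.

Lemma continuous_wgt_pos : {within D, continuous (fun z => wgt_pos t0 K eps z)}.
Proof. by apply: continuous_subspaceT; exact: wgt_pos_continuous. Qed.

Lemma continuous_wgt : {within D, continuous w}.
Proof. by apply: within_continuousX2; exact: continuous_wgt_pos. Qed.

Lemma continuous_energy_density : {within D, continuous energy_density}.
Proof.
apply: within_continuousD.
  by apply: within_continuousM; [exact: continuous_powR|apply: within_continuousX2; exact: continuous_psi].
by do 2?[apply: within_continuousD]; apply: within_continuousX2; exact: continuous_chi.
Qed.

Lemma continuous_dissipation : {within D, continuous dissipation}.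
Proof.
apply: within_continuousM; last by apply: within_continuousX2; exact: continuous_psi.
by apply: within_continuousM; [exact: continuous_powR|exact: continuous_timeV].
Qed.

Lemma continuous_source : {within D, continuous source}.
Proof.
apply: within_continuousM; last by apply: within_continuousX2; exact: continuous_box.
by apply: within_continuousM; [exact: continuous_powR|exact: continuous_time].
Qed.

Lemma continuous_cutoff_speed : {within D, continuous (fun z => G z)}.
Proof.
by apply: within_continuousM; [exact: within_continuous_cst|exact: continuous_wgt_pos].
Qed.

Lemma continuous_dt_energy : {within D, continuous dt_energy}.
Proof.
have c2 : {within D, continuous (fun=> 2 : R)} by exact: within_continuous_cst.
have cc i : {within D, continuous (fun z => 2 * chi i z * dt D (chi i) z)}.
  apply: within_continuousM; last exact: continuous_partial_dx.
  by apply: within_continuousM => //; exact: continuous_chi.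
apply: within_continuousD.
  apply: within_continuousM.
    by apply: within_continuousM; [exact: within_continuous_cst|exact: continuous_cutoff_speed].
  by apply: within_continuousM; [exact: within_continuous_cst|exact: continuous_energy_density].
apply: within_continuousM; first exact: continuous_wgt.
apply: within_continuousM; first exact: within_continuous_cst.
apply: within_continuousD; last first.
  by apply: within_continuousD => //; exact: within_continuousD.
apply: within_continuousD.
  apply: within_continuousM; last by apply: within_continuousX2; exact: continuous_psi.
  apply: within_continuousM; last exact: continuous_timeV.
  by apply: within_continuousM; [exact: within_continuous_cst|exact: continuous_powR].
apply: within_continuousM; first exact: continuous_powR.
apply: within_continuousM; last exact: continuous_partial_dt.
by apply: within_continuousM => //; exact: continuous_psi.
Qed.

Lemma continuous_dx_flux i y : continuous y -> {within D, continuous (dx_flux i y)}.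
Proof.
move=> cy; apply: within_continuousD.
  apply: within_continuousM.
    apply: within_continuousM.
      by apply: within_continuousN; exact: continuous_cutoff_speed.
    apply: within_continuousM; first exact: within_continuous_cst.
    exact: continuous_subspaceT.
  by apply: within_continuousM; [exact: continuous_psi|exact: continuous_chi].
apply: within_continuousM; first exact: continuous_wgt.
apply: within_continuousD; apply: within_continuousM.
- exact: continuous_partial_dt.
- exact: continuous_chi.
- exact: continuous_psi.
- exact: continuous_partial_dx.
Qed.

Lemma weighted_energy_density_ineq (z : pt) : D z ->
  dt_energy z + p * (w z * dissipation z) <=
  (4 * p)^-1 * (w z * source z) + flux1 z + flux2 z + flux3 z.
Proof.
move=> Dz; have /slabP/andP[tz _] := Dz.
have z1 : 0 < z.1 := lt_le_trans t00 tz.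
(* The interchange of derivatives cancels [chi_i d_t chi_i], from the energy, against
   [chi_i d_i psi], from the flux. *)
have S i : dx D i psi z = dt D (chi i) z by exact: partialC.
have a0 : 0 < z.1 `^ (2 * p) by exact: powR_gt0.
have Ka : 1 <= K * z.1 `^ (2 * p).
  apply: (le_trans Kt0); apply: ler_wpM2l => //.
  by apply: ge0_ler_powR; rewrite ?nnegrE ?mulr_ge0 ?(ltW p0) ?(ltW t00) ?(ltW z1).
have Gz : 0 <= G z by rewrite mulr_ge0 ?wgt_pos_ge0// mulr_ge0// ltW.
have yP : 0 < G z ->
    (eps * z.2.1.1) ^+ 2 + (eps * z.2.1.2) ^+ 2 + (eps * z.2.2) ^+ 2 <= 1.
  by rewrite pmulr_rgt0 ?mulr_gt0//; exact: wgt_pos_gt0.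
have FE : box p D phi z = - dt D psi z - 3 * p / z.1 * psi z
    + (z.1 `^ (2 * p))^-1 * (dx D 0 (chi 0) z + dx D 1 (chi 1) z + dx D 2 (chi 2) z).
  by rewrite /box /laplacian sum3E.
exact: (@energy_density_ineq R p z.1 _ K _ _ _ _ _ _ _ _ _ _ _ _ _ _ _ _ _ _ _ _
  p0 z1 a0 K1 Ka Gz (wgt_ge0 t0 K eps z) yP FE (S 0) (S 1) (S 2)).
Qed.

Lemma is_derive_weighted_energy (t : R) x : t0 < t < t1 ->
  is_derive t (1 : R) (fun s => w (s, x) * (2^-1 * energy_density (s, x))) (dt_energy (t, x)).
Proof.
move=> tt; have /andP[t0t _] := tt; have tp : 0 < t := lt_trans t00 t0t.
have hw := is_derive_wgt_t t0 K eps t x.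
have ha := is_derive1_powR (2 * p) tp.
have hpsi := is_derive_sqr (is_derive_dt x C1_dt tt).
have hchi i := is_derive_sqr (is_derive_dt x (C1_dx i) tt).
have he := is_derive_add (is_derive_mul ha hpsi)
  (is_derive_add (is_derive_add (hchi 0) (hchi 1)) (hchi 2)).
have h := is_derive_mul hw (is_derive_mul (is_derive_cst (2^-1 : R) t 1) he).
apply: (is_derive_eq h).
have tpow : t `^ (2 * p - 1) = t `^ (2 * p) / t.
  by rewrite powRB ?(gt_eqF tp) ?implybT// powRr1// ltW.
exact: (@dt_energy_algebra R p t (t `^ (2 * p)) _ K (4 * eps * wgt_pos t0 K eps (t, x)) tpow).
Qed.

Lemma vanish_off_cube (z : pt) : D z -> ~ cube eps^-1 z.2 ->
  wgt_pos t0 K eps z = 0.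
Proof. by move=> /slabP/andP[tz _]; exact: wgt_pos_cube. Qed.

Lemma wgt_eq0 z : wgt_pos t0 K eps z = 0 -> w z = 0.
Proof. by rewrite /wgt => ->; rewrite expr0n. Qed.

Lemma dx_flux_eq0 i y z : wgt_pos t0 K eps z = 0 -> dx_flux i y z = 0.
Proof. by move=> z0; rewrite /dx_flux (wgt_eq0 z0) z0 mulr0 oppr0 !mul0r addr0. Qed.

Lemma continuous_slab_slice (f : pt -> R) t : t0 <= t < t1 ->
  {within D, continuous f} -> continuous (fun x => f (t, x)).
Proof. by move=> tt; apply: slice_continuous; rewrite /= in_itv. Qed.

(** On each line in the first coordinate the flux is the derivative of [w psi chi_0], which the
    weight makes compactly supported. The other two directions go the same way. *)
Lemma integral_flux1 (t : R) : t0 <= t < t1 -> (\int[vol3]_x (flux1 (t, x))%:E = 0)%E.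
Proof.
move=> tt; have /andP[t0t _] := tt.
have c1 : continuous (fun z : pt => z.2.1.1).
  by move=> z; exact: (cvg_comp _ _ (cvg_comp _ _ cvg_snd cvg_fst) cvg_fst).
have cf := continuous_slab_slice tt (@continuous_dx_flux 0 _ c1).
apply: (@integral3_eq0_x1 _ _ eps^-1) => //.
  by move=> x nx; apply: dx_flux_eq0; apply: vanish_off_cube => //; exact/slabP.
move=> x2 x3.
apply: (@integral_derive_compact_support _
  (fun s => w (t, (s, x2, x3)) * (psi (t, (s, x2, x3)) * chi 0 (t, (s, x2, x3))))
  (fun s => flux1 (t, (s, x2, x3))) eps^-1); first by rewrite invr_gt0.
- move=> s.
  have h := is_derive_mul (is_derive_wgt_x1 t0 K eps t s x2 x3)
    (is_derive_mul (is_derive_dx1 s x2 x3 C1_dt tt) (is_derive_dx1 s x2 x3 (C1_dx 0) tt)).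
  by apply: (is_derive_eq h); exact: dx_flux_algebra.
- move=> s; apply: (@continuous_comp _ _ _ (fun s => (s, x2, x3)) (fun x => flux1 (t, x))); last exact: cf.
  exact: (cvg_comp _ _ (@pair_continuousl R R x2 s) (@pair_continuousl (R * R)%type R x3 (s, x2))).
- move=> s; rewrite in_itv/= -ltr_norml -leNgt => sL.
  have w0 : wgt_pos t0 K eps (t, (s, x2, x3)) = 0 by apply: wgt_pos_eq0 => //=; rewrite sL.
  by rewrite (wgt_eq0 w0) mul0r (dx_flux_eq0 _ _ w0).
Qed.

Lemma integral_flux2 (t : R) : t0 <= t < t1 -> (\int[vol3]_x (flux2 (t, x))%:E = 0)%E.
Proof.
move=> tt; have /andP[t0t _] := tt.
have c2 : continuous (fun z : pt => z.2.1.2).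
  by move=> z; exact: (cvg_comp _ _ (cvg_comp _ _ cvg_snd cvg_fst) cvg_snd).
have cf := continuous_slab_slice tt (@continuous_dx_flux 1 _ c2).
apply: (@integral3_eq0_x2 _ _ eps^-1) => //.
  by move=> x nx; apply: dx_flux_eq0; apply: vanish_off_cube => //; exact/slabP.
move=> x1 x3.
apply: (@integral_derive_compact_support _
  (fun s => w (t, (x1, s, x3)) * (psi (t, (x1, s, x3)) * chi 1 (t, (x1, s, x3))))
  (fun s => flux2 (t, (x1, s, x3))) eps^-1); first by rewrite invr_gt0.
- move=> s.
  have h := is_derive_mul (is_derive_wgt_x2 t0 K eps t x1 s x3)
    (is_derive_mul (is_derive_dx2 x1 s x3 C1_dt tt) (is_derive_dx2 x1 s x3 (C1_dx 1) tt)).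
  by apply: (is_derive_eq h); exact: dx_flux_algebra.
- move=> s; apply: (@continuous_comp _ _ _ (fun s => (x1, s, x3)) (fun x => flux2 (t, x))); last exact: cf.
  exact: (cvg_comp _ _ (@pair_continuousr R R x1 s) (@pair_continuousl (R * R)%type R x3 (x1, s))).
- move=> s; rewrite in_itv/= -ltr_norml -leNgt => sL.
  have w0 : wgt_pos t0 K eps (t, (x1, s, x3)) = 0.
    by apply: wgt_pos_eq0 => //=; rewrite sL orbT.
  by rewrite (wgt_eq0 w0) mul0r (dx_flux_eq0 _ _ w0).
Qed.

Lemma integral_flux3 (t : R) : t0 <= t < t1 -> (\int[vol3]_x (flux3 (t, x))%:E = 0)%E.
Proof.
move=> tt; have /andP[t0t _] := tt.
have c3 : continuous (fun z : pt => z.2.2).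
  by move=> z; exact: (cvg_comp _ _ cvg_snd cvg_snd).
have cf := continuous_slab_slice tt (@continuous_dx_flux 2 _ c3).
apply: (@integral3_eq0_x3 _ _ eps^-1) => //.
  by move=> x nx; apply: dx_flux_eq0; apply: vanish_off_cube => //; exact/slabP.
move=> x1 x2.
apply: (@integral_derive_compact_support _
  (fun s => w (t, (x1, x2, s)) * (psi (t, (x1, x2, s)) * chi 2 (t, (x1, x2, s))))
  (fun s => flux3 (t, (x1, x2, s))) eps^-1); first by rewrite invr_gt0.
- move=> s.
  have h := is_derive_mul (is_derive_wgt_x3 t0 K eps t x1 x2 s)
    (is_derive_mul (is_derive_dx3 x1 x2 s C1_dt tt) (is_derive_dx3 x1 x2 s (C1_dx 2) tt)).
  by apply: (is_derive_eq h); exact: dx_flux_algebra.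
- move=> s; apply: (@continuous_comp _ _ _ (fun s => (x1, x2, s)) (fun x => flux3 (t, x))); last exact: cf.
  exact: pair_continuousr.
- move=> s; rewrite in_itv/= -ltr_norml -leNgt => sL.
  have w0 : wgt_pos t0 K eps (t, (x1, x2, s)) = 0.
    by apply: wgt_pos_eq0 => //=; rewrite sL !orbT.
  by rewrite (wgt_eq0 w0) mul0r (dx_flux_eq0 _ _ w0).
Qed.

(** The pointwise inequality is integrated over [[t0, b]] times space: time integration leaves the
    two boundary energies, and the three fluxes integrate to zero. The weight makes every term
    integrable, so the integrals may be split. *)
Lemma weighted_energy_ineq (b : R) (H := `[t0, b]%classic `*` [set: R * R * R]) :
  t0 < b -> b < t1 ->
  (\int[vol3]_x (w (b, x) * (2^-1 * energy_density (b, x)))%:E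
     + p%:E * \int[vol4]_(z in H) (w z * dissipation z)%:E
   <= \int[vol3]_x (w (t0, x) * (2^-1 * energy_density (t0, x)))%:E
     + ((4 * p)^-1)%:E * \int[vol4]_(z in H) (w z * source z)%:E)%E.
Proof.
move=> t0b bt1.
have mH : measurable H by apply: measurableX => //; exact: measurable_itv.
have cx1 : continuous (fun z : pt => z.2.1.1).
  by move=> z; exact: (cvg_comp _ _ (cvg_comp _ _ cvg_snd cvg_fst) cvg_fst).
have cx2 : continuous (fun z : pt => z.2.1.2).
  by move=> z; exact: (cvg_comp _ _ (cvg_comp _ _ cvg_snd cvg_fst) cvg_snd).
have cx3 : continuous (fun z : pt => z.2.2).
  by move=> z; exact: (cvg_comp _ _ cvg_snd cvg_snd).
have wc (f : pt -> R) : {within D, continuous f} -> {within D, continuous (fun z => w z * f z)}.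
  by move=> cf; apply: within_continuousM; [exact: continuous_wgt|exact: cf].
have w0 (f : pt -> R) z : D z -> ~ cube eps^-1 z.2 -> w z * f z = 0.
  by move=> Dz nz; rewrite (wgt_eq0 (vanish_off_cube Dz nz)) mul0r.
have T0 z : D z -> ~ cube eps^-1 z.2 -> dt_energy z = 0.
  move=> Dz nz; have z0 := vanish_off_cube Dz nz.
  have Z (a c g v e f : R) : g = 0 -> v = 0 -> a * (c * g) * e + v * f = 0.
    by move=> -> ->; rewrite !(mulr0, mul0r) addr0.
  exact: (Z _ _ _ _ _ _ z0 (wgt_eq0 z0)).
have X0 i y z : D z -> ~ cube eps^-1 z.2 -> dx_flux i y z = 0.
  by move=> Dz nz; apply: dx_flux_eq0; exact: vanish_off_cube.
have iw f (cf : {within D, continuous f}) := integrable4_cube (L := eps^-1) bt1 (wc f cf) (w0 f).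
have iT := integrable4_cube (L := eps^-1) bt1 continuous_dt_energy T0.
have iX i y (cy : continuous y) :=
  integrable4_cube (L := eps^-1) bt1 (@continuous_dx_flux i y cy) (X0 i y).
have X30 i y (cy : continuous y) :
    (forall t, t0 <= t < t1 -> (\int[vol3]_x (dx_flux i y (t, x))%:E = 0)%E) ->
    (\int[vol4]_(z in H) (dx_flux i y z)%:E = 0)%E.
  exact: (@integral4_eq0 R t0 t1 b eps^-1 (dx_flux i y) bt1 (@continuous_dx_flux i y cy) (X0 i y)).
have iP := iw _ continuous_dissipation; have iS := iw _ continuous_source.
have ipP := @integrableZl _ _ R vol4 H mH p _ iP.
have icS := @integrableZl _ _ R vol4 H mH (4 * p)^-1 _ iS.
have iD (f g : pt -> \bar R) (jf : vol4.-integrable H f) (jg : vol4.-integrable H g) :=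
  @integrableD _ _ R vol4 H mH f g jf jg.
have cW : {within D, continuous (fun z => w z * (2^-1 * energy_density z))}.
  apply: wc; apply: within_continuousM; first exact: within_continuous_cst.
  exact: continuous_energy_density.
have TE : (\int[vol4]_(z in H) (dt_energy z)%:E =
    \int[vol3]_x (w (b, x) * (2^-1 * energy_density (b, x)))%:E
    - \int[vol3]_x (w (t0, x) * (2^-1 * energy_density (t0, x)))%:E)%E.
  apply: (@integral4_dt R t0 t1 b eps^-1 (fun z => w z * (2^-1 * energy_density z)) dt_energy) => //.
  - exact: continuous_dt_energy.
  - by move=> z Dz nz; split; [exact: T0|exact: (w0 (fun z => 2^-1 * energy_density z))].
  - by move=> t x tt; exact: is_derive_weighted_energy.
(* Finiteness of the weighted initial energy allows it to be moved across the inequality in the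
   extended reals. *)
have fin : (\int[vol3]_x (w (t0, x) * (2^-1 * energy_density (t0, x)))%:E)%E \is a fin_num.
  have tt : t0 <= t0 < t1 by rewrite lexx (lt_trans t0b).
  apply: integrable_fin_num => //.
  apply: (@integrable3_cube R (fun x => w (t0, x) * (2^-1 * energy_density (t0, x))) eps^-1).
    exact: (continuous_slab_slice tt cW).
  move=> x nx; have Dx : D (t0, x) by exact/slabP.
  exact: (w0 (fun z => 2^-1 * energy_density z) (t0, x) Dx nx).
have jX1 := iX 0 _ cx1; have jX2 := iX 1 _ cx2; have jX3 := iX 2 _ cx3.
have EL := @integralD _ _ R vol4 H mH _ _ iT ipP.
have ER1 := @integralD _ _ R vol4 H mH _ _ icS jX1.
have ER2 := @integralD _ _ R vol4 H mH _ _ (iD _ _ icS jX1) jX2.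
have ER3 := @integralD _ _ R vol4 H mH _ _ (iD _ _ (iD _ _ icS jX1) jX2) jX3.
have L := @le_integral _ _ R vol4 H mH _ _ (iD _ _ iT ipP)
  (iD _ _ (iD _ _ (iD _ _ icS jX1) jX2) jX3).
rewrite [leRHS]addeC -leeBlDr//.
apply: (@le_trans _ _ (\int[vol4]_(z in H) ((dt_energy z)%:E + p%:E * (w z * dissipation z)%:E))%E).
  rewrite [leRHS]EL [X in (_ <= X + _)%E]TE [X in (_ <= _ + X)%E](@integralZl _ _ R vol4 H mH _ iP).
  by rewrite addeAC.
apply: (le_trans (L _)).
  move=> [t x] /set_mem[/= + _]; rewrite in_itv/= => /andP[t0t tb].
  rewrite -!EFinM -!EFinD lee_fin; apply: weighted_energy_density_ineq.
  by apply/slabP; rewrite /= t0t (le_lt_trans tb).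
rewrite [leLHS]ER3 [X in (X + _ <= _)%E]ER2 [X in (X + _ + _ <= _)%E]ER1.
rewrite [X in (_ + X <= _)%E](X30 2 _ cx3 integral_flux3) adde0.
rewrite [X in (_ + X <= _)%E](X30 1 _ cx2 integral_flux2) adde0.
rewrite [X in (_ + X <= _)%E](X30 0 _ cx1 integral_flux1) adde0.
by rewrite [leLHS](@integralZl _ _ R vol4 H mH _ iS).
Qed.

End weighted_energy.

(** * Removing the weight *)

(** Fatou's lemma, [f] being the pointwise limit of [wn n * f]. Neither the integral nor [M] is
    required to be finite. *)
Lemma ge0_integral_le_cutoff d (T : measurableType d) (R : realType)
    (mu : {measure set T -> \bar R}) (D : set T) (f : T -> R)
    (wn : nat -> T -> R) (M : \bar R) :
  measurable D -> measurable_fun D f -> (forall n, measurable_fun D (wn n)) ->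
  (forall x, D x -> 0 <= f x) -> (forall n x, D x -> 0 <= wn n x) ->
  (forall x, D x -> wn n x @[n --> \oo] --> (1 : R)) ->
  (forall n, (\int[mu]_(x in D) (wn n x * f x)%:E <= M)%E) ->
  (\int[mu]_(x in D) (f x)%:E <= M)%E.
Proof.
move=> mD mf mw f0 w0 w1 wM.
have fE x : D x -> (f x)%:E = limn_einf (fun n => (wn n x * f x)%:E).
  move=> Dx; have cv : (wn n x * f x)%:E @[n --> \oo] --> (f x)%:E.
    apply: cvg_EFin; first by apply: nearW => n.
    by rewrite -[X in _ --> X]mul1r; apply: cvgMr_tmp; exact: w1.
  by rewrite is_cvg_limn_einfE; [apply/esym/cvg_lim|apply/cvg_ex; eexists; exact: cv].
rewrite (eq_integral (fun x => limn_einf (fun n => (wn n x * f x)%:E))); last first.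
  by move=> x /set_mem; exact: fE.
apply: (@le_trans _ _ (limn_einf (fun n => \int[mu]_(x in D) (wn n x * f x)%:E)%E)).
  apply: (@fatou _ _ _ mu D mD (fun n x => (wn n x * f x)%:E)) => [n|n x Dx].
    by apply/measurable_EFinP; exact: measurable_funM.
  by rewrite lee_fin mulr_ge0 ?f0 ?w0.
rewrite limn_einf_lim; apply: lime_le; first exact: is_cvg_einfs.
apply: nearW => n; apply: (le_trans _ (wM n)).
by apply: ereal_inf_lbound; exists n => /=.
Qed.

(** * Passing from squared quantities to norms, and the constant *)

Lemma sqrtr_le (R : rcfType) (x y : R) : 0 <= y -> x <= y ^+ 2 -> Num.sqrt x <= y.
Proof. by move=> y0 xy; rewrite -[y]ger0_norm// -sqrtr_sqr ler_wsqrtr. Qed.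

(** With [M = E0 + B / (4p)], the supremum is at most [sqrt M], and [2 p Q <= 2 M] bounds the second
    term by [sqrt 2 * sqrt M]; this is the first factor of the constant. The second comes from [sqrt
    M <= sqrt E0 + sqrt (1 / (4p)) * sqrt B]. *)
Lemma sqrte_energy_bound (R : realType) (T : Type) (I : set T) (E : T -> \bar R)
    (p : R) (Q E0 B : \bar R) :
  0 < p -> (0 <= E0)%E -> (0 <= B)%E -> (0 <= Q)%E ->
  (forall t, I t -> E t <= E0 + ((4 * p)^-1)%:E * B)%E ->
  (p%:E * Q <= E0 + ((4 * p)^-1)%:E * B)%E ->
  (ereal_sup [set sqrte (E t) | t in I] + (Num.sqrt (2 * p))%:E * sqrte Q <=
   ((1 + Num.sqrt 2) * (1 + Num.sqrt (4 * p)^-1))%:E * (sqrte E0 + sqrte B))%E.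
Proof.
move=> p0 E00 B0 Q0 hE hQ.
set A := (1 + _) * _.
(* Positivity of the constant makes the right-hand side infinite as soon as [E0] or [B] is, which
   settles those cases. *)
have A0 : 0 < A by rewrite mulr_gt0// ltr_pwDl ?sqrtr_ge0.
case: E0 E00 hE hQ => [e0| |]//; last first.
  by move=> _ _ _; rewrite addye ?gt0_muley ?lte_fin ?leey//; case: (sqrte B) (sqrte_ge0 B).
rewrite lee_fin => e00.
case: B B0 => [b| |]//; last first.
  by move=> _ _ _; rewrite [sqrte +oo]/= addey ?gt0_muley ?lte_fin ?leey.
rewrite lee_fin => b0; rewrite -EFinM -EFinD.
set k := (4 * p)^-1; set M := e0 + k * b => hE hQ.
have k0 : 0 <= k by rewrite invr_ge0 mulr_ge0 ?(ltW p0).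
have M0 : 0 <= M by rewrite addr_ge0// mulr_ge0.
have sM : Num.sqrt M <= Num.sqrt e0 + Num.sqrt k * Num.sqrt b.
  apply: sqrtr_le; first by rewrite addr_ge0 ?mulr_ge0 ?sqrtr_ge0.
  rewrite sqrrD exprMn !sqr_sqrtr// /M -addrA lerD2l addrC lerDl.
  by rewrite mulrn_wge0// !mulr_ge0 ?sqrtr_ge0.
have s1 : (ereal_sup [set sqrte (E t) | t in I] <= (Num.sqrt M)%:E)%E.
  apply: ge_ereal_sup => _ [t /hE eM <-].
  by rewrite -[X in (_ <= X)%E]/(sqrte M%:E) lee_sqrt// lee_fin.
have s2 : ((Num.sqrt (2 * p))%:E * sqrte Q <= (Num.sqrt 2 * Num.sqrt M)%:E)%E.
  rewrite -[X in (X%:E * _)%E]/(Num.sqrt (2 * p)) -[(Num.sqrt (2 * p))%:E]/(sqrte (2 * p)%:E).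
  rewrite -sqrteM ?lee_fin ?mulr_ge0 ?(ltW p0)// EFinM -muleA.
  rewrite sqrteM ?lee_fin// EFinM lee_pmul2l ?lte_fin ?sqrtr_gt0//.
  by rewrite -[X in (_ <= X)%E]/(sqrte M%:E) lee_sqrt// lee_fin.
apply: (le_trans (leeD s1 s2)).
rewrite -[(sqrte e0%:E + sqrte b%:E)%E]/((Num.sqrt e0 + Num.sqrt b)%:E).
rewrite -EFinD -EFinM lee_fin.
apply: (@le_trans _ _ ((1 + Num.sqrt 2) * Num.sqrt M)); first by rewrite mulrDl mul1r.
rewrite /A -mulrA ler_wpM2l ?addr_ge0 ?sqrtr_ge0// (le_trans sM)//.
rewrite mulrDl mul1r lerD ?lerDl ?sqrtr_ge0// mulrDr.
by rewrite lerDr mulr_ge0 ?sqrtr_ge0.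
Qed.

(** * The unweighted energy and dissipation bounds *)

Section energy_estimate.
Context (R : realType) (p t0 t1 : R) (phi : R * (R * R * R) -> R).
Local Notation pt := (R * (R * R * R))%type.
Local Notation D := (slab t0 t1).
Local Notation lam := (@lebesgue_measure R).
Local Notation vol3 := (@vol3 R).
Local Notation vol4 := (@vol4 R).
Context (p0 : 0 < p) (t00 : 0 < t0) (t01 : t0 < t1) (C2phi : C2_in D phi).
Local Notation ed := (energy_density p t0 t1 phi).
Local Notation diss := (dissipation p t0 t1 phi).
Local Notation src := (source p t0 t1 phi).

(** Chosen to satisfy both [1 <= K] and [1 <= K * t0^(2p)], which together give [K >= t^-p] for
    [t >= t0]. Its dependence on [t0] is harmless: [K] enters only through the weight and disappears
    in the limit. *)
Let K := 1 + (t0 `^ (2 * p))^-1.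

Let K1 : 1 <= K.
Proof. by rewrite /K lerDl invr_ge0 powR_ge0. Qed.

Let K0 : 0 <= K.
Proof. exact: le_trans K1. Qed.

Let Kt0 : 1 <= K * t0 `^ (2 * p).
Proof.
by rewrite /K mulrDl mul1r mulVf ?gt_eqF ?powR_gt0// lerDr powR_ge0.
Qed.

Let eps0 (n : nat) : 0 < n.+1%:R^-1 :> R.
Proof. by rewrite invr_gt0 ltr0n. Qed.

Local Notation w n := (wgt t0 K n.+1%:R^-1).

Let mD : measurable D.
Proof. by apply: measurableX => //; exact: measurable_itv. Qed.

Let mS (f : pt -> R) : {within D, continuous f} -> measurable_fun D f.
Proof. exact: within_continuous_measurable_slab. Qed.

Let cw n : {within D, continuous (w n)}.
Proof. exact: continuous_wgt. Qed.

Lemma energy_density_ge0 z : 0 <= ed z.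
Proof. by rewrite /energy_density !addr_ge0 ?sqr_ge0// mulr_ge0 ?sqr_ge0 ?powR_ge0. Qed.

Lemma source_ge0 z : D z -> 0 <= src z.
Proof.
move=> /slabP/andP[tz _]; rewrite /source mulr_ge0 ?sqr_ge0// mulr_ge0 ?powR_ge0//.
exact: le_trans (ltW t00) tz.
Qed.

Lemma dissipation_ge0 z : D z -> 0 <= diss z.
Proof.
move=> /slabP/andP[tz _]; rewrite /dissipation mulr_ge0 ?sqr_ge0// divr_ge0 ?powR_ge0//.
exact: le_trans (ltW t00) tz.
Qed.

Lemma wgt_cvg1 z : w n z @[n --> \oo] --> (1 : R).
Proof.
have h : (n.+1%:R^-1 : R) @[n --> \oo] --> (0 : R) by exact: cvg_harmonic.
have c : wgt_arg t0 K n.+1%:R^-1 z @[n --> \oo] --> (1 : R).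
  rewrite /wgt_arg [X in _ --> X](_ : _ = 1 - 2 * K * 0 * (z.1 - t0)
    - 0 * 0 * (z.2.1.1 ^+ 2 + z.2.1.2 ^+ 2 + z.2.2 ^+ 2)); last by ring.
  apply: cvgB; last by apply: cvgMr_tmp; apply: cvgM.
  by apply: cvgB; [exact: cvg_cst|apply: cvgMr_tmp; apply: cvgMl_tmp].
have m : wgt_pos t0 K n.+1%:R^-1 z @[n --> \oo] --> (1 : R).
  have cm : {for 1, continuous (fun y : R => Num.max y 0)}.
    by apply: (@continuous_max _ _ id (cst 0)); [exact: cvg_id|exact: cvg_cst].
  rewrite [X in _ --> X](_ : _ = Num.max (1 : R) 0); first exact: (cvg_comp _ _ c cm).
  by apply/esym/max_idPl.
by rewrite -[X in _ --> X]mulr1; apply: cvgM.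
Qed.

Local Notation E t := (\int[vol3]_x (2^-1 * ed (t, x))%:E)%E.
Local Notation S := (\int[vol4]_(z in D) (src z)%:E)%E.

Lemma energyE t : t0 <= t < t1 -> energy p D phi t = E t.
Proof.
move=> tt; rewrite /energy space_integralE.
rewrite -(@ge0_integralZl_EFin _ _ R vol3 setT measurableT).
- by apply: eq_integral => x _; rewrite -EFinM sum3E.
- by move=> x _; rewrite lee_fin sum3E; exact: (energy_density_ge0 (t, x)).
- apply/measurable_EFinP; apply: continuous_measurable3.
  apply: (continuous_slab_slice (f := fun z => z.1 `^ (2 * p) * dt D phi z ^+ 2
    + \sum_(i < 3) dx D i phi z ^+ 2) tt).
  rewrite (_ : (fun z => _) = ed); first exact: continuous_energy_density.
  by apply/funext => z; rewrite sum3E.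
- by rewrite invr_ge0.
Qed.

(** Tonelli's theorem for the extension by zero of [f], so an infinite norm is covered. *)
Lemma L2normE (g f : pt -> R) : measurable_fun D f ->
  (forall z, D z -> g z ^+ 2 = f z) ->
  L2norm t0 t1 g = sqrte (\int[vol4]_(z in D) (f z)%:E)%E.
Proof.
move=> mf gf; congr sqrte; rewrite [RHS]integral_mkcond.
have mfD : measurable_fun setT ((EFin \o f) \_ D).
  by apply/(measurable_restrictT _ mD)/measurable_EFinP.
have fD0 z : (0 <= ((EFin \o f) \_ D) z)%E.
  by rewrite patchE; case: ifPn => // /set_mem Dz; rewrite /= lee_fin -gf// sqr_ge0.
rewrite [RHS](@fubini_tonelli1 _ _ _ _ R lam vol3 _ mfD fD0).
rewrite integral_mkcond; apply: eq_integral => t _; rewrite /fubini_F patchE.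
case: ifPn => [/set_mem tt|tn].
  rewrite space_integralE; apply: eq_integral => x _.
  have Dz : D (t, x) by split.
  by rewrite patchE mem_set//= real_normK ?num_real// gf.
apply/esym/integral0_eq => x _; rewrite patchE memNset// => -[/= tt _].
by move/negP : tn; apply; exact/mem_set.
Qed.

Lemma slice_ed_continuous t : t0 <= t < t1 -> continuous (fun x => 2^-1 * ed (t, x)).
Proof.
move=> tt; apply: (continuous_slab_slice (f := fun z => 2^-1 * ed z) tt).
by apply: within_continuousM; [exact: within_continuous_cst|exact: continuous_energy_density].
Qed.

(** The right-hand side is freed of [n] and [b], by [w <= 1] and by enlarging [[t0, b]] to the whole
    time interval. The weight stays on the left, where it is removed by a limit. *)
Lemma weighted_energy_bound n b (H := `[t0, b]%classic `*` [set: R * R * R]) :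
  t0 < b -> b < t1 ->
  (\int[vol3]_x (w n (b, x) * (2^-1 * ed (b, x)))%:E
     + p%:E * \int[vol4]_(z in H) (w n z * diss z)%:E
   <= E t0 + ((4 * p)^-1)%:E * S)%E.
Proof.
move=> t0b bt1.
have mH : measurable H by apply: measurableX => //; exact: measurable_itv.
have sub : H `<=` D.
  by move=> [t x] [/= + _]; rewrite /slab /= !in_itv/= => /andP[-> /le_lt_trans->].
apply: (le_trans (weighted_energy_ineq p0 t00 (eps0 n) K1 Kt0 C2phi t0b bt1)).
apply: leeD.
  have tt : t0 <= t0 < t1 by rewrite lexx.
  apply: (@ge0_le_integral _ _ R vol3 setT).
  - by [].
  - by move=> x _; rewrite lee_fin mulr_ge0 ?wgt_ge0// mulr_ge0// energy_density_ge0.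
  - apply/measurable_EFinP; apply: continuous_measurable3.
    apply: (continuous_slab_slice (f := fun z => w n z * (2^-1 * ed z)) tt).
    apply: within_continuousM; first exact: cw.
    by apply: within_continuousM; [exact: within_continuous_cst|exact: continuous_energy_density].
  - apply/measurable_EFinP; apply: continuous_measurable3.
    exact: slice_ed_continuous.
  - move=> x _; rewrite lee_fin ler_piMl ?mulr_ge0 ?energy_density_ge0//.
    by apply: wgt_le1 => //=.
rewrite lee_pmul2l ?lte_fin ?invr_gt0 ?mulr_gt0//.
apply: (@le_trans _ _ (\int[vol4]_(z in H) (src z)%:E)%E).
  apply: (@ge0_le_integral _ _ R vol4 H mH).
  - by move=> z /sub Dz; rewrite lee_fin mulr_ge0 ?wgt_ge0 ?source_ge0.
  - apply/measurable_EFinP; apply: (measurable_funS mD sub); apply: mS.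
    by apply: within_continuousM; [exact: cw|exact: continuous_source].
  - apply/measurable_EFinP; apply: (measurable_funS mD sub); apply: mS.
    exact: continuous_source.
  - move=> z /sub Dz; rewrite lee_fin ler_piMl ?source_ge0//; apply: wgt_le1 => //.
    by have /slabP/andP[] := Dz.
apply: (@ge0_subset_integral _ _ R vol4 H D mH mD) sub.
- by apply/measurable_EFinP; apply: mS; exact: continuous_source.
- by move=> z Dz; rewrite lee_fin source_ge0.
Qed.

Lemma energy_bound t : t0 <= t < t1 -> (E t <= E t0 + ((4 * p)^-1)%:E * S)%E.
Proof.
(* The initial time is treated apart, because the weighted inequality needs a time interval of
   positive length. *)
move=> tt; have /andP[] := tt; rewrite le_eqVlt => /predU1P[<- _|t0t tt1].
  rewrite leeDl// mule_ge0 ?lee_fin ?invr_ge0 ?mulr_ge0 ?(ltW p0)//.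
  by apply: integral_ge0 => z Dz; rewrite lee_fin source_ge0.
apply: (@ge0_integral_le_cutoff _ _ R vol3 setT (fun x => 2^-1 * ed (t, x))
  (fun n x => w n (t, x))).
- by [].
- by apply: continuous_measurable3; exact: slice_ed_continuous.
- by move=> n; apply: continuous_measurable3; apply: (continuous_slab_slice tt); exact: cw.
- by move=> x _; rewrite mulr_ge0// energy_density_ge0.
- by move=> n x _; exact: wgt_ge0.
- by move=> x _; exact: wgt_cvg1.
- move=> n; apply: le_trans (weighted_energy_bound n t0t tt1); rewrite leeDl// mule_ge0 ?lee_fin ?(ltW p0)//.
  apply: integral_ge0 => z [/= + _]; rewrite in_itv/= => /andP[tz zt].
  rewrite lee_fin mulr_ge0 ?wgt_ge0 ?dissipation_ge0//; apply/slabP.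
  by rewrite tz (le_lt_trans zt).
Qed.

(** The weight is removed on each closed subinterval [[t0, b n]], and monotone convergence then
    exhausts the slab. *)
Lemma dissipation_bound :
  (p%:E * \int[vol4]_(z in D) (diss z)%:E <= E t0 + ((4 * p)^-1)%:E * S)%E.
Proof.
set M := (_ + _)%E.
have mdiss : measurable_fun D (EFin \o diss).
  by apply/measurable_EFinP; apply: mS; exact: continuous_dissipation.
(* The denominator starts at [2], so that [t0 < b n] already for [n = 0]. *)
pose b (n : nat) := t1 - (t1 - t0) / n.+2%:R.
pose H n := `[t0, b n]%classic `*` [set: R * R * R].
have mH n : measurable (H n) by apply: measurableX => //; exact: measurable_itv.
have t10 : 0 < t1 - t0 by rewrite subr_gt0.
have bt1 n : b n < t1 by rewrite /b gtrBl divr_gt0.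
have t0b n : t0 < b n.
  by rewrite /b ltrBrDr -ltrBrDl ltr_pdivrMr ?ltr0n// ltr_pMr// ltr1n.
have sub n : H n `<=` D.
  move=> [t x] [/= + _]; rewrite /slab /= !in_itv/= => /andP[-> tb].
  by rewrite (le_lt_trans tb).
have bound n : (p%:E * \int[vol4]_(z in H n) (diss z)%:E <= M)%E.
  rewrite -(@ge0_integralZl_EFin _ _ R vol4 (H n) (mH n) (EFin \o diss)); last 3 first.
  - by move=> z /sub Dz; rewrite lee_fin dissipation_ge0.
  - exact: measurable_funS mdiss.
  - exact: ltW.
  apply: (@ge0_integral_le_cutoff _ _ R vol4 (H n) (fun z => p * diss z) (fun m => w m)).
  - exact: mH.
  - apply: (measurable_funS mD (@sub n)); apply: measurable_funM => //.
    by apply: mS; exact: continuous_dissipation.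
  - by move=> m; apply: (measurable_funS mD (@sub n)); apply: mS; exact: cw.
  - by move=> z /sub Dz; rewrite mulr_ge0 ?dissipation_ge0// ltW.
  - by move=> m z _; exact: wgt_ge0.
  - by move=> z _; exact: wgt_cvg1.
  - move=> m; apply: le_trans (weighted_energy_bound m (t0b n) (bt1 n)).
    apply: (@le_trans _ _ (p%:E * \int[vol4]_(z in H n) (w m z * diss z)%:E)%E).
      rewrite -(@ge0_integralZl_EFin _ _ R vol4 (H n) (mH n) (fun z => (w m z * diss z)%:E)).
      + rewrite le_eqVlt; apply/orP; left; apply/eqP.
        by apply: eq_integral => z _; rewrite -EFinM mulrCA.
      + by move=> z /sub Dz; rewrite lee_fin mulr_ge0 ?wgt_ge0 ?dissipation_ge0.
      + apply/measurable_EFinP; apply: (measurable_funS mD (@sub n)); apply: mS.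
        by apply: within_continuousM; [exact: cw|exact: continuous_dissipation].
      + exact: ltW.
    rewrite leeDr//; apply: integral_ge0 => x _.
    by rewrite lee_fin mulr_ge0 ?wgt_ge0// mulr_ge0// energy_density_ge0.
have UH : \bigcup_n H n = D.
  apply/seteqP; split=> [z [n _]|[t x]]; first exact: sub.
  move=> /slabP/andP[/= tz zt]; have tt : 0 < t1 - t by rewrite subr_gt0.
  (* An integer above [(t1 - t0) / (t1 - t)] gives [(t1 - t0) / n.+2 <= t1 - t], that is
     [t <= b n]. *)
  pose n := Num.bound ((t1 - t0) / (t1 - t)); exists n => //; split=> //=.
  rewrite in_itv/= tz/= /b lerBrDr -lerBrDl ler_pdivrMr ?ltr0n// -ler_pdivrMl//.
  rewrite mulrC; apply: (@le_trans _ _ n%:R); last by rewrite ler_nat -addn2 leq_addr.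
  by rewrite ltW// archi_boundP// divr_ge0 ?ltW.
rewrite -UH.
have cv := @ge0_nondecreasing_set_cvg_integral _ (measurableTypeR R *
  (measurableTypeR R * measurableTypeR R * measurableTypeR R))%type R H (EFin \o diss) vol4.
rewrite -lee_pdivlMl//; apply: (cvge_le _ (cv _ mH _ _)).
- by apply: nearW => n; rewrite lee_pdivlMl//; exact: bound.
- move=> m n mn; apply/subsetPset => -[t x] [/= + _]; rewrite in_itv/= => /andP[tz zt].
  split=> //=; rewrite in_itv/= tz/= (le_trans zt)// lerD2l lerN2.
  by rewrite ler_pM2l// lef_pV2 ?posrE ?ltr0n// ler_nat.
- by move=> n; exact: measurable_funS mdiss.
- by move=> n z /sub Dz; rewrite lee_fin dissipation_ge0.
Qed.

End energy_estimate.

Theorem theorem1p1 (R : realType) (p : R) (hp0 : 0 < p) (hp1 : p <= 1) :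
  exists2 A : R, 0 < A &
  forall (t0 t1 : R), 0 < t0 -> t0 < t1 ->
  forall phi : R * (R * R * R) -> R,
  C2_in (slab t0 t1) phi ->
  (ereal_sup [set sqrte (energy p (slab t0 t1) phi t) | t in `[t0, t1[]
   + (Num.sqrt (2 * p))%:E
     * L2norm t0 t1 (fun a => (a.1 `^ (p - 2^-1) * dt (slab t0 t1) phi a)%R)
   <= A%:E
     * (sqrte (energy p (slab t0 t1) phi t0)
        + L2norm t0 t1
            (fun a => (a.1 `^ (p + 2^-1) * box p (slab t0 t1) phi a)%R)))%E.
Proof.
(* The constant of [sqrte_energy_bound]; its second factor carries the blow-up as [p] tends to
   [0]. *)
exists ((1 + Num.sqrt 2) * (1 + Num.sqrt (4 * p)^-1)).
  by rewrite mulr_gt0// ltr_pwDl ?sqrtr_ge0.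
move=> t0 t1 t00 t01 phi C2phi.
have tp z : slab t0 t1 z -> 0 < z.1.
  by move=> /slabP/andP[tz _]; exact: lt_le_trans tz.
have pow2 (t r : R) : (t `^ r) ^+ 2 = t `^ (2 * r).
  by rewrite -powR_mulrn ?powR_ge0// -powRrM mulrC.
have tt : t0 <= t0 < t1 by rewrite lexx.
rewrite (L2normE (f := dissipation p t0 t1 phi)); last 2 first.
- apply: within_continuous_measurable_slab; exact: continuous_dissipation.
- move=> z /tp z0; rewrite exprMn pow2 /dissipation mulrBr mulfV// powRB.
    by rewrite powRr1// ltW.
  by rewrite (gt_eqF z0) implybT.
rewrite (L2normE (f := source p t0 t1 phi)); last 2 first.
- apply: within_continuous_measurable_slab; exact: continuous_source.
- move=> z /tp z0; rewrite exprMn pow2 /source mulrDr mulfV// powRD.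
    by rewrite powRr1// ltW.
  by rewrite (gt_eqF z0) implybT.
rewrite (energyE p t00 C2phi tt); apply: sqrte_energy_bound => //.
- by apply: integral_ge0 => x _; rewrite lee_fin mulr_ge0// energy_density_ge0.
- by apply: integral_ge0 => z Dz; rewrite lee_fin; exact: (@source_ge0 _ _ _ t1).
- by apply: integral_ge0 => z Dz; rewrite lee_fin; exact: (@dissipation_ge0 _ _ _ t1).
- by move=> t; rewrite /= in_itv/= => tt1; rewrite (energyE p t00 C2phi tt1); exact: energy_bound.
- exact: dissipation_bound.
Qed.
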